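(* For each fixed integer $(r,s)\times t$ bimatrix $A$, there is an algorithm that, given a positive integer $n$, $l,u\in\mathbb{Z}_\infty^{nt}$, $b\in\mathbb{Z}^{r+ns}$, and a separable convex function $f:\mathbb{Z}^{nt}\to\mathbb{Z}$ presented by a comparison oracle, solves, in time polynomial in $n$ and $\langle l,u,b,\hat f\rangle$, the program $$\min\left\{f(x)\ :\ x\in\mathbb{Z}^{nt},\ A^{(n)}x=b,\ l\le x\le u\right\}.$$
   Context: $\mathbb{Z}_\infty:=\mathbb{Z}\uplus\{\pm\infty\}$. An integer $(r,s)\times t$ bimatrix is an integer matrix $A$ with two blocks $A_1,A_2$: $A_1$ is the $r\times t$ submatrix consisting of its first $r$ rows and $A_2$ is the $s\times t$ submatrix consisting of its last $s$ rows (a block may be empty). The $n$-fold product of $A$ is the $(r+ns)\times nt$ matrix $$A^{(n)}:=\begin{pmatrix} A_1 & A_1 & \cdots & A_1 \\ A_2 & 0 & \cdots & 0 \\ 0 & A_2 & \cdots & 0 \\ \vdots & \vdots & \ddots & \vdots \\ 0 & 0 & \cdots & A_2 \end{pmatrix}.$$ A function $f$ is separable convex if $f(x)=\sum_i f_i(x_i)$ with each $f_i:\mathbb{Z}\to\mathbb{Z}$ univariate convex. A comparison oracle for $f$ answers, for any two vectors $x,y$, whether or not $f(x)\le f(y)$. $\hat f$ is the maximum value of $|f(x)|$ over the feasible set; it need not be part of the input (and is relevant only when the feasible set is nonempty and finite). $\langle\cdot\rangle$ denotes binary-encoding length. Convention: an algorithm solves an integer programming problem if it either finds an optimal solution $x$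 or concludes that the feasible set is infinite or empty. *)

(* Defs.v *)
From mathcomp Require Import all_boot all_order all_algebra.
From mathcomp Require Import finmap.
From mathcomp Require Import boolp classical_sets functions cardinality.
From mathcomp Require Import constructive_ereal.

Set Implicit Arguments.
Unset Strict Implicit.
Unset Printing Implicit Defensive.

Import Order.TTheory GRing.Theory Num.Theory.
Local Open Scope classical_set_scope.
Local Open Scope ring_scope.

(** * n-fold integer programs

    Bimatrices, bounds and vectors follow MathComp: the block [A_1] of an
    (r,s) x t bimatrix [A] is [usubmx A] and the block [A_2] is [dsubmx A];
    the extended integers are [\bar int]. *)

Lemma sum_const_ord (n m : nat) : (\sum_(i < n) m = n * m)%N.
Proof. by rewrite sum_nat_const card_ord. Qed.

(* The block constructions of matrix.v produce the dimensions
   \sum_(i < n) s and \sum_(j < n) t; the cast turns them into n * s, n * t. *)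
Definition nfold (r s t : nat) (A : 'M[int]_(r + s, t)) (n : nat) :
    'M[int]_(r + n * s, n * t) :=
  castmx (congr1 (addn r) (sum_const_ord n s), sum_const_ord n t)
    (col_mx (\mxrow_(j < n) usubmx A)
            (\mxblock_(i < n, j < n) (if i == j then dsubmx A else 0))).

Definition feasible (r s t : nat) (A : 'M[int]_(r + s, t)) (n : nat)
    (l u : 'cV[\bar int]_(n * t)) (b : 'cV[int]_(r + n * s)) :
    set 'cV[int]_(n * t) :=
  [set x | nfold A n *m x = b /\
           forall i, (l i 0%R <= (x i 0%R)%:E <= u i 0%R)%E].

(* Convexity of the restriction to Z of a function on R, with the denominator
   z - x of the convex combination
   y = ((z - y) / (z - x)) x + ((y - x) / (z - x)) z cleared. *)
Definition convexZ (g : int -> int) : Prop :=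
  forall x y z : int, x <= y -> y <= z ->
    (z - x) * g y <= (z - y) * g x + (y - x) * g z.

Definition separable_convex (N : nat) (f : 'cV[int]_N -> int) : Prop :=
  exists2 g : 'I_N -> int -> int,
    (forall i, convexZ (g i)) & (forall x, f x = \sum_i g i (x i 0)).

Definition minimizer (N : nat) (S : set 'cV[int]_N) (f : 'cV[int]_N -> int)
    (x : 'cV[int]_N) : Prop :=
  S x /\ forall y, S y -> f x <= f y.

(* [fset_set S] is empty when S is infinite, so this is the maximum of |f| over
   S when S is finite and nonempty, and 0 in the two cases where that maximum
   plays no role. *)
Definition fhat (N : nat) (S : set 'cV[int]_N) (f : 'cV[int]_N -> int) : nat :=
  \max_(x <- fset_set S) `|f x|%N.

(** Binary encoding lengths: <z> = 1 + ceil(log2(|z| + 1)). *)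

Definition bitlen (z : int) : nat := (up_log 2 `|z|.+1).+1.

Definition bitlen_ext (e : \bar int) : nat :=
  if e is z%:E%E then bitlen z else 1%N.

Definition bitlen_vec (N : nat) (x : 'cV[int]_N) : nat :=
  (\sum_i bitlen (x i 0%R))%N.

Definition bitlen_evec (N : nat) (x : 'cV[\bar int]_N) : nat :=
  (\sum_i bitlen_ext (x i 0%R))%N.

(** * Oracle algorithms

    An algorithm is an expression of a small call-by-value language with loops
    whose values are binary trees with integer leaves.  The semantics is
    instrumented with a logarithmic (bit) cost: each elementary operation is
    charged the bit sizes of its operands and of its result.  The language is
    Turing complete, and a run of cost T can be simulated by a Turing machine in
    time polynomial in T, so polynomial cost is polynomial time. *)

Inductive val : Type :=
| Leaf of int
| Node of val & val.

Fixpoint vsize (v : val) : nat :=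
  match v with
  | Leaf z => bitlen z
  | Node v1 v2 => (vsize v1 + vsize v2).+1
  end.

Inductive op1 : Type := Fst | Snd | IsNode.

Inductive op2 : Type := MkNode | Add | Sub | Mul | Div | Leq.

(* Variables are de Bruijn indices into an environment.  [Bind e1 e2] is
   "let x := e1 in e2".  [Loop test body] runs on the state held by variable 0:
   while [test] holds the state is replaced by the value of [body], and the last
   state is returned.  [Query e1 e2] calls the oracle. *)
Inductive expr : Type :=
| Var of nat
| Const of val
| Op1 of op1 & expr
| Op2 of op2 & expr & expr
| Bind of expr & expr
| If of expr & expr & expr
| Loop of expr & expr
| Query of expr & expr.

Definition to_int (v : val) : int := if v is Leaf z then z else 0.

Definition of_bool (c : bool) : val := Leaf (if c then 1 else 0).

Definition truthy (v : val) : bool := if v is Leaf z then z != 0 else true.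

Definition apply1 (o : op1) (v : val) : val :=
  match o, v with
  | Fst, Node v1 _ => v1
  | Snd, Node _ v2 => v2
  | IsNode, Node _ _ => of_bool true
  | _, Leaf _ => Leaf 0
  end.

Definition apply2 (o : op2) (v w : val) : val :=
  match o with
  | MkNode => Node v w
  | Add => Leaf (to_int v + to_int w)
  | Sub => Leaf (to_int v - to_int w)
  | Mul => Leaf (to_int v * to_int w)
  | Div => Leaf (to_int v %/ to_int w)%Z
  | Leq => of_bool (to_int v <= to_int w)
  end.

(* [eval O E e v c]: in the environment E and with the oracle O, the expression e
   evaluates to v at cost c. *)
Inductive eval (O : val -> val -> bool) : seq val -> expr -> val -> nat -> Prop :=
| EvalVar E i :
    eval O E (Var i) (nth (Leaf 0) E i) (vsize (nth (Leaf 0) E i)).+1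
| EvalConst E v :
    eval O E (Const v) v (vsize v).+1
| EvalOp1 E o e v c :
    eval O E e v c ->
    eval O E (Op1 o e) (apply1 o v) (c + vsize v + vsize (apply1 o v)).+1
| EvalOp2 E o e1 e2 v1 v2 c1 c2 :
    eval O E e1 v1 c1 -> eval O E e2 v2 c2 ->
    eval O E (Op2 o e1 e2) (apply2 o v1 v2)
      (c1 + c2 + vsize v1 + vsize v2 + vsize (apply2 o v1 v2)).+1
| EvalBind E e1 e2 v1 v2 c1 c2 :
    eval O E e1 v1 c1 -> eval O (v1 :: E) e2 v2 c2 ->
    eval O E (Bind e1 e2) v2 (c1 + c2).+1
| EvalIf E e e1 e2 v w c c' :
    eval O E e v c -> eval O E (if truthy v then e1 else e2) w c' ->
    eval O E (If e e1 e2) w (c + vsize v + c').+1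
| EvalLoopStop E test body x v c :
    eval O (x :: E) test v c -> ~~ truthy v ->
    eval O (x :: E) (Loop test body) x (c + vsize v + vsize x).+1
| EvalLoopStep E test body x y w v c c' c'' :
    eval O (x :: E) test v c -> truthy v ->
    eval O (x :: E) body y c' ->
    eval O (y :: E) (Loop test body) w c'' ->
    eval O (x :: E) (Loop test body) w (c + vsize v + c' + c'').+1
| EvalQuery E e1 e2 v1 v2 c1 c2 :
    eval O E e1 v1 c1 -> eval O E e2 v2 c2 ->
    eval O E (Query e1 e2) (of_bool (O v1 v2))
      (c1 + c2 + vsize v1 + vsize v2 + vsize (of_bool (O v1 v2))).+1.

Lemma eval_det O E e v c v' c' :
  eval O E e v c -> eval O E e v' c' -> v = v' /\ c = c'.
Proof.
move=> ev; elim: ev v' c' => {E e v c}; intros;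
  repeat match goal with
  | IH : forall v' c', eval _ ?E ?e v' c' -> ?v = v' /\ ?c = c',
    H : eval _ ?E ?e ?v ?c |- _ => clear H
  end;
  match goal with ev : eval _ _ _ ?w ?d |- _ = ?w /\ _ = ?d => inversion ev end;
  subst;
  repeat match goal with
  | IH : forall v' c', eval _ ?E ?e v' c' -> _, H : eval _ ?E ?e _ _ |- _ =>
      destruct (IH _ _ H); clear H IH; subst
  end;
  try match goal with
  | H : is_true (truthy ?x), H' : is_true (~~ truthy ?x) |- _ => by rewrite H in H'
  end; by [].
Qed.

(** * Encoding of instances and answers *)

Definition enc_list (s : seq val) : val := foldr Node (Leaf 0) s.

Definition enc_ext (e : \bar int) : val :=
  match e with
  | z%:E%E => Node (Leaf 0) (Leaf z)
  | +oo%E => Leaf 1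
  | -oo%E => Leaf (-1)
  end.

Definition enc_vec (N : nat) (x : 'cV[int]_N) : val :=
  enc_list [seq Leaf (x i 0) | i <- enum 'I_N].

Definition enc_evec (N : nat) (x : 'cV[\bar int]_N) : val :=
  enc_list [seq enc_ext (x i 0) | i <- enum 'I_N].

Definition enc_input (n N M : nat) (l u : 'cV[\bar int]_N) (b : 'cV[int]_M) : val :=
  Node (Leaf n%:Z) (Node (enc_evec l) (Node (enc_evec u) (enc_vec b))).

(* Queries that do not encode two vectors of Z^N are answered negatively. *)
Definition cmp_oracle (N : nat) (f : 'cV[int]_N -> int) (v w : val) : bool :=
  `[< exists x y, [/\ v = enc_vec x, w = enc_vec y & f x <= f y] >].

Inductive answer (N : nat) : Type :=
| Optimal of 'cV[int]_N
| Infinite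
| Empty.
Arguments Infinite {N}.
Arguments Empty {N}.

Definition enc_answer (N : nat) (a : answer N) : val :=
  match a with
  | Optimal x => Node (Leaf 0) (enc_vec x)
  | Infinite => Leaf 1
  | Empty => Leaf 0
  end.

Definition solves (N : nat) (S : set 'cV[int]_N) (f : 'cV[int]_N -> int)
    (a : answer N) : Prop :=
  match a with
  | Optimal x => minimizer S f x
  | Infinite => ~ finite_set S
  | Empty => S = set0
  end.

(* Main.v *)
Require Import Defs.
From mathcomp Require Import all_boot all_order all_algebra.
From mathcomp Require Import boolp classical_sets functions cardinality.
From mathcomp Require Import constructive_ereal.
From mathcomp Require Import zify ring lra.

(** The algorithm is Graver-best augmentation, run on all of Z^(nt) by means of
    a violation function instead of on a lattice of feasible directions.

    Geometry.  Call u conformal to w (with respect to M) when every coordinate of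
    u and of M u lies between 0 and the same coordinate of w, resp. M w.  The
    decisive fact is [graver_bound]: there is a constant g, depending on A only,
    such that every nonzero w in Z^(nt) has a nonzero d conformal to it, with
    respect to the n-fold product of A, whose 1-norm is at most g.  By Dickson's
    lemma every brick of w is a conformal sum of finitely many vectors v_i; the
    vector counting how often each v_i occurs dominates, again by Dickson's lemma
    and conformally for the linking rows, one out of finitely many count vectors,
    and keeping only that many v_i out of the bricks of w gives d.  Hence
    w = sum_q mu_q d_q with conformal terms, where the d_q enumerate the vectors of
    1-norm at most g; there are only polynomially many of them, namely
    Q = (2nt + 1)^g with repetitions.

    Descent.  Let H be a separable convex function of the coordinates of z and
    M z, where M is the n-fold product of A, and let z* be a minimizer.  Decompose
    z* - z as above.  Separable convex functions are superadditive along conformal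
    sums, so one of the steps
    mu_q d_q gains at least a fraction 1/Q of the gap H z - H z*; by convexity
    along the line through d_q, a step 2^k d_q with 2^k <= mu_q gains at least
    half of that.  Trying all q and all k therefore shrinks the gap by the factor
    1 - 1/(2Q), and a number of rounds polynomial in Q and in the bit length of
    the initial gap closes it, the values being integers ([descent]).

    Two descents solve the program.  The first one starts at 0 and minimizes the
    violation |b - M z|_1 + (distance of z to the box [l, u]), a separable convex
    function of the coordinates of z and M z; the feasible set is empty iff the
    minimum is positive ([repair_descent]).  If it is not empty, it is infinite
    iff some nonzero d_q is a recession direction: otherwise a bound blocks every
    nonzero d_q in the kernel of M, which bounds all mu_q and hence all feasible
    points.  In the finite case the second descent minimizes f, moving inside the
    feasible set and asking only the oracle ([improve_descent]); its initial gap is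
    at most twice the maximum of |f|.

    Cost.  No program is written down.  [ptime] says of a function that some
    expression evaluates it at a cost polynomial in the size of its input, and
    the rules for [ptime] follow the constructors of the language, so that each
    ingredient of the two descents is shown to be computable from its defining
    formula. *)

Set Implicit Arguments.
Unset Strict Implicit.
Unset Printing Implicit Defensive.

Import Order.TTheory GRing.Theory Num.Theory.
Local Open Scope ring_scope.

Local Notation value := Defs.val.

(** * Sizes of values *)

Lemma bitlen_leq (z : int) m : (`|z| < 2 ^ m)%N -> (bitlen z <= m.+1)%N.
Proof. by move=> h; rewrite /bitlen ltnS up_log_min. Qed.

Lemma ltn_bitlen (z : int) : (`|z| < 2 ^ (bitlen z).-1)%N.
Proof. exact: up_logP. Qed.

Lemma bitlen_gt0 z : (0 < bitlen z)%N. Proof. by []. Qed.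

Lemma bitlen_monotone (a b : int) : (`|a| <= `|b|)%N -> (bitlen a <= bitlen b)%N.
Proof. by move=> h; rewrite /bitlen ltnS leq_up_log. Qed.

Lemma bitlenD a b : (bitlen (a + b) <= bitlen a + bitlen b)%N.
Proof.
have ha := ltn_bitlen a; have hb := ltn_bitlen b.
have ga := bitlen_gt0 a; have gb := bitlen_gt0 b.
case: (bitlen a) ga ha => // p _ ha; case: (bitlen b) gb hb => // q _ hb.
rewrite addnS; apply: bitlen_leq; rewrite addSn expnS.
apply: (@leq_ltn_trans (`|a| + `|b|)); first lia.
rewrite /= in ha hb.
have h1 : (2 ^ p <= 2 ^ (p + q))%N by rewrite leq_exp2l ?leq_addr.
have h2 : (2 ^ q <= 2 ^ (p + q))%N by rewrite leq_exp2l ?leq_addl.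
lia.
Qed.

Lemma bitlenM a b : (bitlen (a * b) <= bitlen a + bitlen b)%N.
Proof.
have ha := ltn_bitlen a; have hb := ltn_bitlen b.
have ga := bitlen_gt0 a; have gb := bitlen_gt0 b.
case: (bitlen a) ga ha => // p _ ha; case: (bitlen b) gb hb => // q _ hb.
rewrite addnS; apply: bitlen_leq; rewrite addSn expnS expnD abszM.
rewrite /= in ha hb; nia.
Qed.

Lemma bitlenN a : bitlen (- a) = bitlen a.
Proof. by rewrite /bitlen abszN. Qed.

Lemma bitlen_div a b : (bitlen (a %/ b)%Z <= (bitlen a).+1)%N.
Proof.
have := bitlenD a 1; rewrite [bitlen 1](_ : _ = 2%N) // => _.
have ha := ltn_bitlen a; case: (bitlen a) (bitlen_gt0 a) ha => // p _ /= ha.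
apply: bitlen_leq; rewrite expnS.
suff : (`|(a %/ b)%Z| <= `|a| + 1)%N by have := expn_gt0 2 p; lia.
have [->|b0] := eqVneq b 0; first by rewrite divz0; lia.
case: (ltrP 0 b) => hb; last first.
  have -> : b = - `|b| by rewrite ler0_norm ?opprK.
  rewrite divzN abszN; have : 0 < `|b| by rewrite normr_gt0.
  move: `|b| => {b0}{}b {}hb; have := divz_eq a b; have := ltz_pmod a hb.
  have : 0 <= (a %% b)%Z by rewrite modz_ge0 // gt_eqF.
  move: (a %/ b)%Z (a %% b)%Z => q m; nia.
have := divz_eq a b; have := ltz_pmod a hb.
have : 0 <= (a %% b)%Z by rewrite modz_ge0.
move: (a %/ b)%Z (a %% b)%Z => q m; nia.
Qed.

Lemma vsize_apply1 o v : (vsize (apply1 o v) <= (vsize v).+2)%N.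
Proof. by case: o; case: v => [z|v1 v2] //=; rewrite ?[bitlen _]/=; lia. Qed.

Lemma bitlen_to_int v : (bitlen (to_int v) <= vsize v)%N.
Proof. by case: v. Qed.

Lemma vsize_of_bool b : (vsize (of_bool b) <= 2)%N.
Proof. by case: b. Qed.

Lemma vsize_apply2 o v w : (vsize (apply2 o v w) <= (vsize v + vsize w).+2)%N.
Proof.
have hv := bitlen_to_int v; have hw := bitlen_to_int w.
case: o => /=.
- lia.
- have := bitlenD (to_int v) (to_int w); lia.
- have := bitlenD (to_int v) (- to_int w); rewrite bitlenN; lia.
- have := bitlenM (to_int v) (to_int w); lia.
- have := bitlen_div (to_int v) (to_int w); lia.
- exact: leq_trans (vsize_of_bool (to_int v <= to_int w)) _.
Qed.

Lemma eval_vsize O E e v c : eval O E e v c -> (vsize v < c)%N.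
Proof. by elim=> *; lia. Qed.

(** * Functions computable in polynomial time *)

(** A context is a family of inputs: [inp x] is the value handed to a program,
    [orc x] the oracle at its disposal, and [sz x] an extra size that the cost may
    depend on although the program cannot read it, such as the bit length of the
    maximum of |f|.  Proof-level data of an instance live in [idx]. *)
Record ctx := Ctx {
  idx :> Type;
  orc : idx -> value -> value -> bool;
  sz : idx -> nat;
  inp : idx -> value }.

Definition insize (G : ctx) (x : G) : nat := (sz x + vsize (inp x)).+2.

Definition pbounded (G : ctx) (q : G -> nat) : Prop :=
  exists k, forall x, (q x <= insize x ^ k)%N.

(** The output is again a family of values over the same index type.  Since the
    environment [E] below the input is arbitrary, such expressions may be placed
    under binders without shifting variables. *)
Definition ptime (G : ctx) (o : G -> value) : Prop :=
  exists e q, pbounded q /\ forall x E, exists2 c,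
    eval (orc x) (inp x :: E) e (o x) c & (c <= q x)%N.

(** Contexts with one more piece of data paired to the input serve to state that
    the body of a loop is computable from the input and the loop state. *)
Definition ext (G : ctx) (A : G -> Type) (eA : forall x, A x -> value) : ctx :=
  @Ctx {x : G & A x} (fun p => orc (tag p)) (fun p => sz (tag p))
       (fun p => Node (inp (tag p)) (eA (tag p) (tagged p))).

(** Restricting the inputs expresses preconditions; it is what allows a loop that
    terminates only on some inputs to stand in one branch of a conditional. *)
Definition restr (G : ctx) (P : G -> Prop) : ctx :=
  @Ctx {x : G | P x} (fun p => orc (sval p)) (fun p => sz (sval p))
       (fun p => inp (sval p)).

Lemma leq_exp2l_base a b k : (a <= b)%N -> (a ^ k <= b ^ k)%N.
Proof. by case: k => // k h; rewrite leq_exp2r. Qed.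

Section PolynomialBounds.
Variable G : ctx.
Implicit Types q : G -> nat.

Lemma insize_gt1 (x : G) : (1 < insize x)%N. Proof. by []. Qed.

Lemma pbounded_le q q' : pbounded q' -> (forall x, q x <= q' x)%N -> pbounded q.
Proof. by case=> k hk le; exists k => x; apply: leq_trans (le x) (hk x). Qed.

Lemma pbounded_const n : pbounded (fun _ : G => n).
Proof.
exists n => x; apply: (@leq_trans (2 ^ n)); first exact: ltnW (ltn_expl _ _).
exact: leq_exp2l_base.
Qed.

Lemma pbounded_mul q q' : pbounded q -> pbounded q' -> pbounded (fun x => q x * q' x)%N.
Proof. by case=> k hk [l hl]; exists (k + l)%N => x; rewrite expnD leq_mul. Qed.

Lemma pbounded_add q q' : pbounded q -> pbounded q' -> pbounded (fun x => q x + q' x)%N.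
Proof.
case=> k hk [l hl]; exists (k + l).+1 => x.
have h1 : (insize x ^ k <= insize x ^ (k + l))%N by rewrite leq_exp2l // leq_addr.
have h2 : (insize x ^ l <= insize x ^ (k + l))%N by rewrite leq_exp2l // leq_addl.
have := hk x; have := hl x; have := insize_gt1 x; rewrite expnS; nia.
Qed.

Lemma pbounded_exp q k : pbounded q -> pbounded (fun x => q x ^ k)%N.
Proof. by case=> l hl; exists (l * k)%N => x; rewrite expnM; case: k => // k;
  rewrite leq_exp2r. Qed.

Lemma pbounded_S q : pbounded q -> pbounded (fun x => (q x).+1).
Proof. by move=> h; apply: (pbounded_le (pbounded_add h (pbounded_const 1))) => x;
  rewrite addn1. Qed.

Lemma pbounded_insize : pbounded (@insize G).
Proof. by exists 1%N => x; rewrite expn1. Qed.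

Lemma pbounded_sz : pbounded (@sz G).
Proof. by apply: (pbounded_le pbounded_insize) => x; rewrite /insize; lia. Qed.

Lemma pbounded_inp : pbounded (fun x : G => vsize (inp x)).
Proof. by apply: (pbounded_le pbounded_insize) => x; rewrite /insize; lia. Qed.

(** Writing down a result is charged, so a cheap result is short: this is how the
    cost of composed programs stays polynomial. *)
Lemma pbounded_vsize (o : G -> value) : ptime o -> pbounded (fun x => vsize (o x)).
Proof.
case=> e [q [pq h]]; apply: (pbounded_le pq) => x.
by have [c /eval_vsize hc le] := h x [::]; lia.
Qed.

End PolynomialBounds.

(** Polynomials compose: a bound in the size of [phi x] is a bound in the size of
    [x] when the former size is polynomial in the latter. *)
Lemma pbounded_subst (G H : ctx) (phi : G -> H) (q : H -> nat) :
  pbounded q -> pbounded (fun x => insize (phi x)) -> pbounded (fun x => q (phi x)).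
Proof. by case=> k hk p; apply: (pbounded_le (pbounded_exp k p)) => x; apply: hk. Qed.

Ltac poly_bound := repeat first
  [ assumption | exact: pbounded_const | exact: pbounded_sz | exact: pbounded_inp | exact:
    pbounded_insize
  | apply: pbounded_add | apply: pbounded_mul | apply: pbounded_S | apply: pbounded_exp |
    (apply: pbounded_vsize; assumption) ].

Section Rules.
Variable G : ctx.
Implicit Types o a b : G -> value.

Lemma ptime_eq o o' : (forall x, o x = o' x) -> ptime o -> ptime o'.
Proof. by move=> e [p [q [pq h]]]; exists p, q; split=> // x E; rewrite -e. Qed.

Lemma ptime_inp : ptime (@inp G).
Proof.
exists (Var 0), (fun x => (vsize (inp x)).+1); split; first by poly_bound.
by move=> x E; exists (vsize (inp x)).+1 => //; apply: (@EvalVar _ (inp x :: E) 0).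
Qed.

Lemma ptime_const v : ptime (fun _ : G => v).
Proof.
exists (Const v), (fun=> (vsize v).+1); split; first by poly_bound.
by move=> x E; exists (vsize v).+1 => //; constructor.
Qed.

Lemma ptime_op1 op a : ptime a -> ptime (fun x => apply1 op (a x)).
Proof.
case=> e [q [pq h]]; exists (Op1 op e), (fun x => 3 * (q x) + 6)%N; split; first by poly_bound.
move=> x E; have [c ev le] := h x E; eexists; first exact: EvalOp1 ev.
by have := eval_vsize ev; have := vsize_apply1 op (a x); lia.
Qed.

Lemma ptime_op2 op a b : ptime a -> ptime b -> ptime (fun x => apply2 op (a x) (b x)).
Proof.
case=> e [q [pq h]] [e' [q' [pq' h']]].
exists (Op2 op e e'), (fun x => 3 * (q x + q' x) + 6)%N; split; first by poly_bound.
move=> x E; have [c ev le] := h x E; have [c' ev' le'] := h' x E.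
eexists; first exact: EvalOp2 ev ev'.
have := eval_vsize ev; have := eval_vsize ev'; have := vsize_apply2 op (a x) (b x); lia.
Qed.

Lemma ptime_query a b : ptime a -> ptime b -> ptime (fun x => of_bool (orc x (a x) (b x))).
Proof.
case=> e [q [pq h]] [e' [q' [pq' h']]].
exists (Query e e'), (fun x => 3 * (q x + q' x) + 6)%N; split; first by poly_bound.
move=> x E; have [c ev le] := h x E; have [c' ev' le'] := h' x E.
eexists; first exact: EvalQuery ev ev'.
have := eval_vsize ev; have := eval_vsize ev'; have := vsize_of_bool (orc x (a x) (b x)); lia.
Qed.

Lemma truthy_of_bool (b : bool) : truthy (of_bool b) = b.
Proof. by case: b. Qed.

Lemma ptime_if_restr (c : G -> bool) a b : ptime (fun x => of_bool (c x)) ->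
  ptime (fun p : restr c => a (sval p)) ->
  ptime (fun p : restr (fun x => ~~ c x) => b (sval p)) ->
  ptime (fun x => if c x then a x else b x).
Proof.
case=> e [q [pq h]] [e1 [q1 [[k1 p1] h1]]] [e2 [q2 [[k2 p2] h2]]].
exists (If e e1 e2), (fun x => 2 * q x + insize x ^ k1 + insize x ^ k2 + 1)%N.
split; first by poly_bound.
move=> x E; have [d ev le] := h x E; have hs := eval_vsize ev.
case hc: (c x).
  have [d1 ev1 le1] := h1 (exist _ x hc) E; have /= := p1 (exist _ x hc).
  rewrite /insize /= => p1'; eexists.
    by apply: (EvalIf ev); rewrite truthy_of_bool hc; exact: ev1.
  by move: hs; rewrite /insize /=; lia.
have hc' := negbT hc.
have [d1 ev1 le1] := h2 (exist _ x hc') E; have /= := p2 (exist _ x hc').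
rewrite /insize /= => p1'; eexists.
  by apply: (EvalIf ev); rewrite truthy_of_bool hc; exact: ev1.
by move: hs; rewrite /insize /=; lia.
Qed.

End Rules.

(** Composition of programs, realized by [Bind]: the input of the second program
    is computed by the first one. *)
Lemma ptime_subst (G H : ctx) (phi : G -> H) (o : H -> value) :
  (forall x, orc (phi x) = orc x) -> pbounded (fun x => sz (phi x)) ->
  ptime (fun x => inp (phi x)) -> ptime o -> ptime (fun x => o (phi x)).
Proof.
move=> ho hs hi [e [q [pq h]]]; case: (hi) => e' [q' [pq' h']].
exists (Bind e' e), (fun x => (q' x + q (phi x)).+1); split.
  apply: pbounded_S; apply: pbounded_add => //; apply: pbounded_subst pq _.
  by rewrite /insize; poly_bound; exact: pbounded_vsize.
move=> x E; have [c ev le] := h' x E.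
have [c' ev' le'] := h (phi x) (inp x :: E); rewrite ho in ev'.
by eexists; [exact: EvalBind ev ev' | lia].
Qed.

Section Derived.
Variable G : ctx.
Implicit Types o a b : G -> value.

Lemma ptime_restr (P : G -> Prop) o : ptime o -> ptime (fun p : restr P => o (sval p)).
Proof.
apply: (@ptime_subst (restr P) G sval) => //; first exact: (@pbounded_sz (restr P)).
exact: (@ptime_inp (restr P)).
Qed.

Lemma ptime_if (c : G -> bool) a b : ptime (fun x => of_bool (c x)) ->
  ptime a -> ptime b -> ptime (fun x => if c x then a x else b x).
Proof. by move=> hc ha hb; apply: ptime_if_restr => //; exact: ptime_restr. Qed.

Lemma ptime_node a b : ptime a -> ptime b -> ptime (fun x => Node (a x) (b x)).
Proof. exact: (@ptime_op2 _ MkNode). Qed.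

Lemma ptime_fst a b : ptime (fun x => Node (a x) (b x)) -> ptime a.
Proof. exact: (@ptime_op1 _ Fst). Qed.

Lemma ptime_snd a b : ptime (fun x => Node (a x) (b x)) -> ptime b.
Proof. exact: (@ptime_op1 _ Snd). Qed.

End Derived.

Section Extension.
Variables (G : ctx) (A : G -> Type) (eA : forall x, A x -> value).
Implicit Types o : G -> value.

Lemma ptime_top : ptime (fun p : ext eA => eA (tagged p)).
Proof.
exact: (@ptime_snd (ext eA) (fun p => inp (tag p)) _ (@ptime_inp (ext eA))).
Qed.

Lemma ptime_weak o : ptime o -> ptime (fun p : ext eA => o (tag p)).
Proof.
apply: (@ptime_subst (ext eA) G tag) => //; first exact: (@pbounded_sz (ext eA)).
exact: (@ptime_fst (ext eA) _ (fun p => eA (tagged p)) (@ptime_inp (ext eA))).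
Qed.

End Extension.

(** The number of rounds [M] enters only through a polynomial bound and is not
    computed by the program; it may depend on the unknown function behind the
    oracle.  A bound on the size of all intermediate states is indispensable:
    repeated squaring takes few rounds but exponential cost. *)
Section While.
Variables (G : ctx) (A : G -> Type) (eA : forall x, A x -> value).
Variables (a0 : forall x, A x) (step : forall x, A x -> A x).
Variables (test : forall x, A x -> bool) (M : G -> nat) (S : G -> nat).
Arguments test : clear implicits.
Arguments step : clear implicits.

Hypothesis c0 : ptime (fun x => eA (a0 x)).
Hypothesis ctest : ptime (fun p : ext eA => of_bool (test (tag p) (tagged p))).
Hypothesis cstep : ptime (fun p : ext eA => eA (step (tag p) (tagged p))).
Hypothesis pM : pbounded M.
Hypothesis pS : pbounded S.
Hypothesis bound : forall x j, (j <= M x)%N ->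
  (vsize (eA (iter j (step x) (a0 x))) <= S x)%N.
Hypothesis run : forall x j, (j < M x)%N -> test x (iter j (step x) (a0 x)).
Hypothesis stop : forall x, ~~ test x (iter (M x) (step x) (a0 x)).

Lemma ptime_while : ptime (fun x => eA (iter (M x) (step x) (a0 x))).
Proof.
case: c0 => e0 [q0 [pq0 h0]]; case: ctest => et [qt [[kt pqt] ht]].
case: cstep => es [qs [[ks pqs] hs]].
pose B x := (insize x + S x).+1.
have pB : pbounded B by rewrite /B; poly_bound.
pose body := Op2 MkNode (Op1 Fst (Var 0)) es.
pose cst x := (3 * B x ^ kt + 3 * B x ^ ks + 20 * B x + 20)%N.
pose q x := (q0 x + 20 * insize x + 20 + (M x).+1 * cst x + 5 * S x)%N.
exists (Bind (Op2 MkNode (Var 0) e0) (Op1 Snd (Loop et body))), q; split.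
  by rewrite /q /cst; poly_bound.
(* The loop state keeps the input next to the current value. *)
move=> x E; have [d ev le] := h0 x E.
pose st j := Node (inp x) (eA (iter j (step x) (a0 x))).
have szle j : (j <= M x)%N ->
    (insize (existT _ x (iter j (step x) (a0 x)) : ext eA) <= B x)%N.
  by move=> /bound; rewrite /B /insize /=; lia.
have szst j : (j <= M x)%N -> (vsize (st j) <= B x)%N.
  by move/szle; rewrite /insize /st /=; lia.
have evT E' j : (j <= M x)%N -> exists2 c,
    eval (orc x) (st j :: E') et (of_bool (test x (iter j (step x) (a0 x)))) c &
    (c <= B x ^ kt)%N.
  move=> /szle le_j; have [c evt lt] := ht (existT _ x (iter j (step x) (a0 x))) E'.
  by exists c => //; apply: leq_trans (leq_trans lt (pqt _)) (leq_exp2l_base kt le_j).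
have evS E' j : (j <= M x)%N -> exists2 c,
    eval (orc x) (st j :: E') es (eA (step x (iter j (step x) (a0 x)))) c &
    (c <= B x ^ ks)%N.
  move=> /szle le_j; have [c evs ls] := hs (existT _ x (iter j (step x) (a0 x))) E'.
  by exists c => //; apply: leq_trans (leq_trans ls (pqs _)) (leq_exp2l_base ks le_j).
(* The remaining cost is bounded by the number k of rounds still to come. *)
have main E' k j : (j + k = M x)%N -> exists2 c,
   eval (orc x) (st j :: E') (Loop et body) (st (M x)) c & (c <= k.+1 * cst x)%N.
  elim: k j => [|k IH] j jk.
    have {jk} jM : j = M x by lia.
    have le_j : (j <= M x)%N by rewrite jM.
    have [c evt le1] := evT E' _ le_j.
    have -> : st (M x) = st j by rewrite jM.
    eexists; first by apply: EvalLoopStop evt _; rewrite truthy_of_bool jM.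
    have := eval_vsize evt; have := szst _ le_j.
    by rewrite mul1n /cst; lia.
  have jM : (j < M x)%N by lia.
  have [c evt le1] := evT E' _ (ltnW jM).
  have [c' evs le2] := evS E' _ (ltnW jM).
  have [c2 ev2 le3] := IH j.+1 (ltac:(lia)).
  eexists.
    apply: EvalLoopStep ev2; [exact: evt | by rewrite truthy_of_bool run |].
    apply: EvalOp2; last exact: evs.
    by apply: (@EvalOp1 _ _ Fst (Var 0) (st j)); apply: (@EvalVar _ (st j :: E') 0).
  have := eval_vsize evt; have := eval_vsize evs.
  have := szst j (ltnW jM); have := szst j.+1 jM.
  rewrite mulSn; have := erefl (cst x); rewrite {1}/cst /st /=; lia.
have [c evl ll] := main (inp x :: E) (M x) 0 (add0n _).
eexists.
  apply: EvalBind; first by apply: EvalOp2 ev; apply: (@EvalVar _ (inp x :: E) 0).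
  exact: (@EvalOp1 _ _ Snd _ (st (M x)) _ evl).
have := bound (leqnn (M x)); have := bound (leq0n (M x)); rewrite /q /insize /st /=; lia.
Qed.
End While.

(** * Arithmetic, counted loops and lists *)

Section Arith.
Variable G : ctx.
Implicit Types (f g : G -> int) (b c : G -> bool).

Lemma ptime_int (z : int) : ptime (fun _ : G => Leaf z).
Proof. exact: ptime_const. Qed.

Lemma ptime_add f g : ptime (fun x => Leaf (f x)) -> ptime (fun x => Leaf (g x)) ->
  ptime (fun x => Leaf (f x + g x)).
Proof. by move=> h h'; apply: (ptime_eq _ (ptime_op2 Add h h')). Qed.

Lemma ptime_sub f g : ptime (fun x => Leaf (f x)) -> ptime (fun x => Leaf (g x)) ->
  ptime (fun x => Leaf (f x - g x)).
Proof. by move=> h h'; apply: (ptime_eq _ (ptime_op2 Defs.Sub h h')). Qed.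

Lemma ptime_mul f g : ptime (fun x => Leaf (f x)) -> ptime (fun x => Leaf (g x)) ->
  ptime (fun x => Leaf (f x * g x)).
Proof. by move=> h h'; apply: (ptime_eq _ (ptime_op2 Mul h h')). Qed.

Lemma ptime_div f g : ptime (fun x => Leaf (f x)) -> ptime (fun x => Leaf (g x)) ->
  ptime (fun x => Leaf (f x %/ g x)%Z).
Proof. by move=> h h'; apply: (ptime_eq _ (ptime_op2 Div h h')). Qed.

Lemma ptime_le f g : ptime (fun x => Leaf (f x)) -> ptime (fun x => Leaf (g x)) ->
  ptime (fun x => of_bool (f x <= g x)).
Proof. by move=> h h'; apply: (ptime_eq _ (ptime_op2 Leq h h')). Qed.

Lemma ptime_ifz c f g : ptime (fun x => of_bool (c x)) ->
  ptime (fun x => Leaf (f x)) -> ptime (fun x => Leaf (g x)) ->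
  ptime (fun x => Leaf (if c x then f x else g x)).
Proof.
move=> hc hf hg; apply: (ptime_eq _ (ptime_if hc hf hg)) => x /=; by case: (c x).
Qed.

Lemma ptime_neg b : ptime (fun x => of_bool (b x)) -> ptime (fun x => of_bool (~~ b x)).
Proof.
move=> h; apply: (ptime_eq _ (ptime_if h (ptime_int 0) (ptime_int 1))) => x /=.
by case: (b x).
Qed.

Lemma ptime_and b c : ptime (fun x => of_bool (b x)) -> ptime (fun x => of_bool (c x)) ->
  ptime (fun x => of_bool (b x && c x)).
Proof.
move=> h h'; apply: (ptime_eq _ (ptime_if h h' (ptime_int 0))) => x /=.
by case: (b x).
Qed.

Lemma ptime_lt f g : ptime (fun x => Leaf (f x)) -> ptime (fun x => Leaf (g x)) ->
  ptime (fun x => of_bool (f x < g x)).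
Proof.
move=> h h'; apply: (ptime_eq _ (ptime_neg (ptime_le h' h))) => x /=.
by rewrite ltNge.
Qed.

Lemma ptime_eqz f g : ptime (fun x => Leaf (f x)) -> ptime (fun x => Leaf (g x)) ->
  ptime (fun x => of_bool (f x == g x)).
Proof.
move=> h h'; apply: (ptime_eq _ (ptime_and (ptime_le h h') (ptime_le h' h))) => x /=.
by rewrite eq_le.
Qed.

Lemma ptime_abs f : ptime (fun x => Leaf (f x)) -> ptime (fun x => Leaf `|f x|).
Proof.
move=> h; apply: (ptime_eq _ (ptime_ifz (ptime_le (ptime_int 0) h) h (ptime_sub (ptime_int 0) h))).
by move=> x /=; case: lerP => h1; rewrite ?sub0r ?(ger0_norm h1) ?(ltr0_norm h1).
Qed.

Implicit Types m n : G -> nat.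

Lemma ptime_addn m n : ptime (fun x => Leaf (m x)) -> ptime (fun x => Leaf (n x)) ->
  ptime (fun x => Leaf (m x + n x)%N).
Proof. by move=> h h'; apply: (ptime_eq _ (ptime_add h h')) => x; rewrite PoszD. Qed.

Lemma ptime_muln m n : ptime (fun x => Leaf (m x)) -> ptime (fun x => Leaf (n x)) ->
  ptime (fun x => Leaf (m x * n x)%N).
Proof. by move=> h h'; apply: (ptime_eq _ (ptime_mul h h')) => x; rewrite PoszM. Qed.

Lemma ptime_subn m n : ptime (fun x => Leaf (m x)) -> ptime (fun x => Leaf (n x)) ->
  ptime (fun x => Leaf (m x - n x)%N).
Proof.
move=> h h'; apply: (ptime_eq _ (ptime_ifz (ptime_le h h') (ptime_int 0) (ptime_sub h h'))) => x /=.
by congr Leaf; case: lerP; lia.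
Qed.

Lemma ptime_divn m n : ptime (fun x => Leaf (m x)) -> ptime (fun x => Leaf (n x)) ->
  ptime (fun x => Leaf (m x %/ n x)%N).
Proof. by move=> h h'; apply: (ptime_eq _ (ptime_div h h')) => x; rewrite divz_nat. Qed.

Lemma ptime_modn m n : ptime (fun x => Leaf (m x)) -> ptime (fun x => Leaf (n x)) ->
  ptime (fun x => Leaf (m x %% n x)%N).
Proof.
move=> h h'.
apply: (ptime_eq _ (ptime_subn h (ptime_muln (ptime_divn h h') h'))) => x /=.
congr (Leaf (Posz _)); rewrite {1}(divn_eq (m x) (n x)); lia.
Qed.

Lemma ptime_expn m k : ptime (fun x => Leaf (m x)) -> ptime (fun x => Leaf (m x ^ k)%N).
Proof.
move=> h; elim: k => [|k IH]; first exact: (ptime_int 1).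
by apply: (ptime_eq _ (ptime_muln h IH)) => x; rewrite expnS.
Qed.

Lemma ptime_eqn m n : ptime (fun x => Leaf (m x)) -> ptime (fun x => Leaf (n x)) ->
  ptime (fun x => of_bool (m x == n x)).
Proof. exact: ptime_eqz. Qed.

Lemma ptime_ltn m n : ptime (fun x => Leaf (m x)) -> ptime (fun x => Leaf (n x)) ->
  ptime (fun x => of_bool (m x < n x)%N).
Proof. exact: ptime_lt. Qed.

Lemma ptime_leqn m n : ptime (fun x => Leaf (m x)) -> ptime (fun x => Leaf (n x)) ->
  ptime (fun x => of_bool (m x <= n x)%N).
Proof. exact: ptime_le. Qed.

End Arith.

(** The context for the body of a sum or of a comprehension: an index is added to
    the input. *)
Definition extn (G : ctx) : ctx := ext (fun (_ : G) (j : nat) => Leaf j).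

Lemma ptime_topn (G : ctx) : ptime (fun p : extn G => Leaf (tagged p)).
Proof. exact: (ptime_top (fun (_ : G) (j : nat) => Leaf j)). Qed.

Lemma bitlen_nat (j : nat) : (bitlen j <= j.+1)%N.
Proof. apply: bitlen_leq; rewrite absz_nat; exact: ltn_expl. Qed.

(** Indices are written in binary, so an index by itself is not polynomial in the
    size of its encoding; below a polynomial [N] there is a bound uniform in the
    index. *)
Lemma pbounded_extn (G : ctx) (q : extn G -> nat) (N : G -> nat) : pbounded q -> pbounded N ->
  exists2 S, pbounded S & forall x j, (j <= N x)%N -> (q (existT _ x j) <= S x)%N.
Proof.
case=> k hk pN; exists (fun x => (insize x + N x + 10) ^ k)%N; first by poly_bound.
move=> x j le; apply: leq_trans (hk _) _; apply: leq_exp2l_base.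
by have := bitlen_nat j; rewrite /insize /=; lia.
Qed.

Section For.
Variables (G : ctx) (A : G -> Type) (eA : forall x, A x -> value).
Arguments eA : clear implicits.

(** The context for the body of a counted loop: input, counter, current value. *)
Definition ext2 : ctx := @ext (extn G) (fun p => A (tag p)) (fun p => eA (tag p)).

Lemma ptime_top2 : ptime (fun p : ext2 => eA (tag (tag p)) (tagged p)).
Proof. exact: (ptime_top (fun p : extn G => eA (tag p))). Qed.

Lemma ptime_weakn (o : extn G -> value) : ptime o -> ptime (fun p : ext2 => o (tag p)).
Proof. exact: (ptime_weak (fun p : extn G => eA (tag p))). Qed.

Lemma ptime_idx2 : ptime (fun p : ext2 => Leaf (tagged (tag p))).
Proof. exact: (ptime_weakn (@ptime_topn G)). Qed.

Lemma ptime_weak2 (o : G -> value) : ptime o -> ptime (fun p : ext2 => o (tag (tag p))).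
Proof. by move=> h; exact: (ptime_weakn (ptime_weak (fun (_ : G) (j : nat) => Leaf j) h)).
Qed.

Lemma ptime_for (a0 : forall x, A x) (step : forall x, nat -> A x -> A x) (N S : G -> nat) :
  ptime (fun x => Leaf (N x)) -> pbounded N -> ptime (fun x => eA x (a0 x)) ->
  ptime (fun p : ext2 => eA (tag (tag p)) (step (tag (tag p)) (tagged (tag p)) (tagged p))) ->
  pbounded S ->
  (forall x j, (j <= N x)%N -> (vsize (eA x (iteri j (step x) (a0 x))) <= S x)%N) ->
  ptime (fun x => eA x (iteri (N x) (step x) (a0 x))).
Proof.
move=> cN pN c0 cs pS bd.
pose B x := (nat * A x)%type.
pose eB x (p : B x) := Node (Leaf p.1) (eA x p.2).
pose st x (p : B x) : B x := (p.1.+1, step x p.1 p.2).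
have itE x j : iter j (st x) (0%N, a0 x) = (j, iteri j (step x) (a0 x)).
  by elim: j => //= j ->.
pose tst x (p : B x) := (p.1 < N x)%N.
have cB := ptime_top eB.
have cj : ptime (fun p : ext eB => Leaf (tagged p).1) := ptime_fst cB.
have h : ptime (fun x => eB x (iter (N x) (st x) (0%N, a0 x))).
  apply: (@ptime_while _ _ eB _ st tst N (fun x => (N x + S x + 5)%N)) => //.
  - by apply: ptime_node => //; exact: (ptime_int _ 0).
  - by apply: ptime_ltn => //; apply: (ptime_weak eB cN).
  - apply: ptime_node => /=.
      by apply: (ptime_eq _ (ptime_addn cj (ptime_int _ 1))) => p; rewrite addn1.
    pose phi (p : ext eB) : ext2 :=
      existT _ (existT _ (tag p) (tagged p).1) (tagged p).2.
    apply: (@ptime_subst (ext eB) ext2 phi) cs => //.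
      exact: (@pbounded_sz (ext eB)).
    apply: ptime_node; last exact: (ptime_snd cB).
    by apply: ptime_node => //; apply: (ptime_weak eB (@ptime_inp G)).
  - by poly_bound.
  - move=> x j le; rewrite itE /eB /=; have := bd x j le; have := bitlen_nat j; lia.
  - by move=> x j le; rewrite itE /tst.
  - by move=> x; rewrite itE /tst /= ltnn.
apply: (@ptime_snd _ (fun x => Leaf (N x)) (fun x => eA x (iteri (N x) (step x) (a0 x)))).
by apply: (ptime_eq _ h) => x; rewrite itE.
Qed.
End For.

Section Sum.
Variable G : ctx.

Lemma ptime_sum (N : G -> nat) (F : G -> nat -> int) :
  ptime (fun x => Leaf (N x)) -> pbounded N ->
  ptime (fun p : extn G => Leaf (F (tag p) (tagged p))) ->
  ptime (fun x => Leaf (\sum_(0 <= j < N x) F x j)).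
Proof.
move=> cN pN cF.
have [S pS hS] := pbounded_extn (pbounded_vsize cF) pN.
have itE x k : iteri k (fun j a => a + F x j) 0 = \sum_(0 <= j < k) F x j.
  by elim: k => [|k /= ->]; rewrite ?big_nil // big_nat_recr.
have step : ptime (fun p : ext2 (fun (_ : G) (a : int) => Leaf a) =>
    Leaf (tagged p + F (tag (tag p)) (tagged (tag p)))).
  apply: ptime_add; first exact: (ptime_top2 (fun (_ : G) (a : int) => Leaf a)).
  exact: (ptime_weakn (fun (_ : G) (a : int) => Leaf a) cF).
have := @ptime_for G (fun=> int) (fun _ a => Leaf a) (fun=> 0) (fun x j a => a + F x j)
  N (fun x => (N x * S x + 1)%N) cN pN (ptime_int _ 0) step.
move=> h; apply: (ptime_eq _ (h _ _)).
- by move=> x; rewrite itE.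
- by poly_bound.
move=> x j le; rewrite itE /=.
apply: (@leq_trans (j * S x + 1)); last by rewrite leq_add2r leq_mul2r le orbT.
elim: j le => [|j IH] le; first by rewrite big_nil.
rewrite big_nat_recr //=; apply: leq_trans (bitlenD _ _) _.
have := IH (ltnW le); have /= := hS x j (ltnW le) => h1 h2.
by apply: leq_trans (leq_add h2 h1) _; rewrite mulSn; lia.
Qed.

Lemma vsize_enc_list s : vsize (enc_list s) = (\sum_(v <- s) (vsize v).+1 + 1)%N.
Proof.
elim: s => [|v s IH]; first by rewrite big_nil.
by rewrite big_cons /= IH; lia.
Qed.

(** A list is built from its last entry on, so that no reversal is needed. *)
Lemma ptime_mkseq (N : G -> nat) (F : G -> nat -> value) :
  ptime (fun x => Leaf (N x)) -> pbounded N ->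
  ptime (fun p : extn G => F (tag p) (tagged p)) ->
  ptime (fun x => enc_list (mkseq (F x) (N x))).
Proof.
move=> cN pN cF.
have [S pS hS] := pbounded_extn (pbounded_vsize cF) pN.
pose st x j a := Node (F x (N x - j.+1)%N) a.
have itE x k : (k <= N x)%N -> iteri k (st x) (Leaf 0) =
    enc_list [seq F x j | j <- iota (N x - k)%N k].
  elim: k => // k IH le; rewrite /= IH 1?ltnW // /st; congr Node.
  by congr (enc_list (map _ (iota _ _))); lia.
pose eV (_ : G) (v : value) := v.
pose E2 := ext2 eV.
have step : ptime (fun p : E2 => st (tag (tag p)) (tagged (tag p)) (tagged p)).
  apply: ptime_node; last exact: (ptime_top2 eV).
  pose phi (p : E2) : extn G :=
    existT _ (tag (tag p)) (N (tag (tag p)) - (tagged (tag p)).+1)%N.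
  apply: (@ptime_subst E2 (extn G) phi) cF => //; first exact: (@pbounded_sz E2).
  apply: ptime_node; first exact: (ptime_weak2 eV (@ptime_inp G)).
  apply: (ptime_eq _ (ptime_subn (ptime_weak2 eV cN)
    (ptime_addn (ptime_idx2 eV) (ptime_int _ 1)))) => p /=.
  by rewrite addn1.
have := @ptime_for G _ eV (fun=> Leaf 0) st
  N (fun x => (N x * (S x).+1 + 1)%N) cN pN (ptime_int _ 0) step.
move=> h; apply: (ptime_eq _ (h _ _)).
- by move=> x; rewrite /eV itE // subnn.
- by poly_bound.
move=> x j le; rewrite /eV itE // vsize_enc_list leq_add2r big_map.
rewrite big_seq; apply: (@leq_trans (\sum_(i <- iota (N x - j) j | i \in iota (N x - j) j) (S
  x).+1)).
  by apply: leq_sum => i; rewrite mem_iota => /andP[_ hi]; rewrite ltnS hS //; lia.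
by rewrite -big_seq big_const_seq count_predT size_iota iter_addn_0 mulnC leq_mul2r le orbT.
Qed.

(** The loop stops at the end of the list, hence takes at most [size (s x)] rounds
    even if the index is exponentially large. *)
Lemma ptime_nth (s : G -> seq value) (k : G -> nat) :
  ptime (fun x => enc_list (s x)) -> ptime (fun x => Leaf (k x)) ->
  ptime (fun x => nth (Leaf 0) (s x) (k x)).
Proof.
move=> cs ck.
pose eB (_ : G) (p : nat * value) := Node (Leaf p.1) p.2.
pose st (_ : G) (p : nat * value) := (p.1.-1, apply1 Snd p.2).
pose tst (_ : G) (p : nat * value) := (0 < p.1)%N && (if p.2 is Node _ _ then true else false).
pose M x := minn (k x) (size (s x)).
have itE x j : (j <= M x)%N -> iter j (st x) (k x, enc_list (s x)) =
    ((k x - j)%N, enc_list (drop j (s x))).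
  elim: j => [|j IH] le; first by rewrite subn0 drop0.
  rewrite iterS IH 1?ltnW // /st; congr pair => /=; first by lia.
  by rewrite (drop_nth (Leaf 0)) //; move: le; rewrite /M; lia.
have cB := ptime_top eB.
have sizes x : (size (s x) <= vsize (enc_list (s x)))%N.
  by rewrite vsize_enc_list; elim: (s x) => [|v s' IH]; rewrite ?big_nil ?big_cons //=; lia.
have pM : pbounded M.
  by apply: (pbounded_le (pbounded_vsize cs)) => x; have := sizes x; rewrite /M; lia.
have h : ptime (fun x => eB x (iter (M x) (st x) (k x, enc_list (s x)))).
  apply: (@ptime_while _ _ eB _ st tst M
    (fun x => (bitlen (k x) + vsize (enc_list (s x)) + 5)%N)) => //.
  - by apply: ptime_node.
  - rewrite /tst; apply: ptime_and.
      by apply: (ptime_ltn (ptime_int _ 0)); apply: (ptime_fst cB).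
    have := ptime_op1 IsNode (ptime_snd cB); apply: ptime_eq => p /=.
    by case: (tagged p).2.
  - apply: ptime_node; last by apply: (ptime_op1 Snd); exact: (ptime_snd cB).
    apply: (ptime_eq _ (ptime_subn (ptime_fst cB) (ptime_int _ 1))) => p /=.
    by rewrite subn1.
  - by apply: pbounded_add; [apply: pbounded_add|]; poly_bound;
    exact: (pbounded_le (pbounded_vsize ck)).
  - move=> x j le; rewrite itE //=.
    have h1 : (bitlen (k x - j)%N <= bitlen (k x))%N by apply: bitlen_monotone;
      rewrite !absz_nat; lia.
    have h2 : (vsize (enc_list (drop j (s x))) <= vsize (enc_list (s x)))%N.
      by rewrite !vsize_enc_list -{2}(cat_take_drop j (s x)) big_cat /=; lia.
    lia.
  - move=> x j lt; rewrite itE 1?ltnW // /tst /=.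
    rewrite (drop_nth (Leaf 0)) /=; last by move: lt; rewrite /M; lia.
    by move: lt; rewrite /M; lia.
  - move=> x; rewrite itE // /tst /= /M.
    case: (leqP (k x) (size (s x))) => hk; first by rewrite subnn.
    by rewrite drop_size andbF.
apply: (ptime_eq _ (ptime_op1 Fst (ptime_snd h))) => x; rewrite itE //= /M.
case: (leqP (k x) (size (s x))) => hk.
  rewrite -[in RHS](cat_take_drop (k x) (s x)) nth_cat size_take_min.
  rewrite (minn_idPl hk) ltnn subnn; by case: (drop _ _).
by rewrite drop_size nth_default // ltnW.
Qed.

End Sum.

(** * Vectors and powers of two *)

Section Vectors.

(** Entries indexed by natural numbers, with a default value outside the range:
    programs compute indices by arithmetic, without proofs that they are in
    range. *)
Definition ent N (z : 'cV[int]_N) (k : nat) : int :=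
  if insub k is Some i then z i 0 else 0.

Lemma entE N (z : 'cV[int]_N) (i : 'I_N) : ent z i = z i 0.
Proof. by rewrite /ent valK. Qed.

Lemma nth_enum_map N (F : 'I_N -> value) k : nth (Leaf 0) [seq F i | i <- enum 'I_N] k =
  if insub k is Some i then F i else Leaf 0.
Proof.
case: insubP => [i lt_k ik|ge_k].
  rewrite (nth_map i) ?size_enum_ord // -ik; congr F; exact: nth_ord_enum.
by rewrite nth_default // size_map size_enum_ord leqNgt.
Qed.

Lemma map_enum_mkseq N (F : nat -> value) :
  [seq F (nat_of_ord i) | i <- enum 'I_N] = mkseq F N.
Proof. by rewrite /mkseq -val_enum_ord -map_comp. Qed.

(** For bounds it is the encoding that is extended by a default, which encodes no
    extended integer. *)
Definition eent N (l : 'cV[\bar int]_N) (k : nat) : value :=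
  nth (Leaf 0) [seq enc_ext (l i 0) | i <- enum 'I_N] k.

Lemma eentE N (l : 'cV[\bar int]_N) (i : 'I_N) : eent l i = enc_ext (l i 0).
Proof. by rewrite /eent nth_enum_map valK. Qed.

Variable G : ctx.

Lemma ptime_ent (N : G -> nat) (z : forall x, 'cV[int]_(N x)) (k : G -> nat) :
  ptime (fun x => enc_vec (z x)) -> ptime (fun x => Leaf (k x)) ->
  ptime (fun x => Leaf (ent (z x) (k x))).
Proof.
move=> cz ck; apply: (ptime_eq _ (ptime_nth cz ck)) => x.
by rewrite nth_enum_map /ent; case: insub.
Qed.

Lemma ptime_eent (N : G -> nat) (l : forall x, 'cV[\bar int]_(N x)) (k : G -> nat) :
  ptime (fun x => enc_evec (l x)) -> ptime (fun x => Leaf (k x)) ->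
  ptime (fun x => eent (l x) (k x)).
Proof. exact: ptime_nth. Qed.

Lemma ptime_col (N : G -> nat) (F : G -> nat -> int) :
  ptime (fun x => Leaf (N x)) -> pbounded N ->
  ptime (fun p : extn G => Leaf (F (tag p) (tagged p))) ->
  ptime (fun x => enc_vec (\col_(j < N x) F x j)).
Proof.
move=> cN pN cF; apply: (ptime_eq _ (@ptime_mkseq _ N (fun x j => Leaf (F x j)) cN pN cF)) => x.
by rewrite /enc_vec -map_enum_mkseq; congr enc_list; apply: eq_map => i; rewrite mxE.
Qed.

Lemma ptime_ecol (N : G -> nat) (F : G -> nat -> \bar int) :
  ptime (fun x => Leaf (N x)) -> pbounded N ->
  ptime (fun p : extn G => enc_ext (F (tag p) (tagged p))) ->
  ptime (fun x => enc_evec (\col_(j < N x) F x j)).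
Proof.
move=> cN pN cF; apply: (ptime_eq _ (@ptime_mkseq _ N (fun x j => enc_ext (F x j)) cN pN cF)) => x.
by rewrite /enc_evec -map_enum_mkseq; congr enc_list; apply: eq_map => i; rewrite mxE.
Qed.

Lemma bitlen_pow2 k : bitlen (2 ^ k)%N = k.+2.
Proof.
by rewrite /bitlen absz_nat (@up_log_eq 2 k) // ltnSn /= ltn_exp2l.
Qed.

Lemma ptime_pow2 (k : G -> nat) : ptime (fun x => Leaf (k x)) -> pbounded k ->
  ptime (fun x => Leaf (2 ^ k x)%N).
Proof.
move=> ck pk.
have itE (x : G) j : iteri j (fun (_ : nat) a => 2 * a)%N 1%N = (2 ^ j)%N.
  by elim: j => //= j ->; rewrite expnS.
have step : ptime (fun p : ext2 (fun (_ : G) (a : nat) => Leaf a) =>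
    Leaf (2 * tagged p)%N).
  by apply: ptime_muln; [exact: (ptime_int _ 2) | exact: (ptime_top2 (fun (_ : G) (a : nat) =>
    Leaf a))].
have := @ptime_for G (fun=> nat) (fun _ a => Leaf a) (fun=> 1%N) (fun x j a => 2 * a)%N
  k (fun x => k x + 2)%N ck pk (ptime_int _ 1) step.
move=> h; apply: (ptime_eq _ (h _ _)) => [x||x j le]; first by rewrite itE.
  by poly_bound.
by rewrite itE // [vsize _]bitlen_pow2; lia.
Qed.

(** The language has no logarithm: powers of two are produced until they exceed
    the given number. *)
Lemma ptime_bitlen (W : G -> nat) : ptime (fun x => Leaf (W x)) ->
  ptime (fun x => Leaf (bitlen (W x))).
Proof.
move=> cW.
pose eB (_ : G) (p : nat * nat) := Node (Leaf p.1) (Leaf p.2).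
pose st (_ : G) (p : nat * nat) := (p.1.+1, 2 * p.2)%N.
pose tst x (p : nat * nat) := (p.2 <= W x)%N.
pose M x := up_log 2 (W x).+1.
have itE x j : iter j (st x) (0, 1)%N = (j, 2 ^ j)%N.
  by elim: j => [|j IH] //; rewrite iterS IH /st expnS.
have cB := ptime_top eB.
have pM : pbounded M by apply: (pbounded_le (pbounded_vsize cW)) => x /=;
  rewrite /bitlen absz_nat /M.
have h : ptime (fun x => eB x (iter (M x) (st x) (0, 1)%N)).
  apply: (@ptime_while _ _ eB _ st tst M (fun x => (2 * M x + 5)%N)) => //.
  - exact: (ptime_const _ (Node (Leaf 0) (Leaf 1))).
  - by apply: (ptime_leqn (ptime_snd cB)); exact: (ptime_weak eB cW).
  - apply: ptime_node.
      by apply: (ptime_eq _ (ptime_addn (ptime_fst cB) (ptime_int _ 1))) => p; rewrite addn1.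
    by apply: ptime_muln (ptime_snd cB); exact: (ptime_int _ 2).
  - by poly_bound.
  - by move=> x j le; rewrite itE /= bitlen_pow2; have := bitlen_nat j; lia.
  - move=> x j; rewrite itE /tst /=; apply: contraLR; rewrite -ltnNge -leqNgt => lt.
    exact: up_log_min.
  - by move=> x; rewrite itE /tst /= -ltnNge; apply: up_logP.
have h2 := ptime_addn (ptime_fst h) (ptime_int _ 1).
apply: (ptime_eq _ h2) => x.
by rewrite itE /bitlen absz_nat addn1.
Qed.

End Vectors.

(** * The violation of the constraints *)

Lemma ptime_wn (G : ctx) (o : G -> value) : ptime o -> ptime (fun p : extn G => o (tag p)).
Proof. exact: ptime_weak. Qed.

Lemma pbounded_weak (G : ctx) (B : G -> Type) (eB : forall x, B x -> value) (q : G -> nat) :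
  pbounded q -> pbounded (fun p : ext eB => q (tag p)).
Proof.
case=> k h; exists k => p; apply: leq_trans (h _) _; apply: leq_exp2l_base.
by rewrite /insize /=; lia.
Qed.

Lemma pbounded_wn (G : ctx) (q : G -> nat) : pbounded q -> pbounded (fun p : extn G => q (tag p)).
Proof. exact: pbounded_weak. Qed.

Definition is_node (v : value) : bool := if v is Node _ _ then true else false.

Section Bounds.
Variable G : ctx.

Lemma ptime_is_node (v : G -> value) : ptime v -> ptime (fun x => of_bool (is_node (v x))).
Proof. by move=> /(ptime_op1 IsNode); apply: ptime_eq => x /=; case: (v x). Qed.

Lemma ptime_to_int (v : G -> value) : ptime v -> ptime (fun x => Leaf (to_int (v x))).
Proof.
move=> cv; apply: (ptime_eq _ (ptime_op2 Defs.Add cv (ptime_int _ 0))) => x /=.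
by rewrite addr0.
Qed.

(** [lo_gap v z] is the distance from [z] to the half-line above the lower bound
    encoded by [v].  An infinite bound of the wrong sign excludes all integers;
    its constant violation 1 keeps the function convex. *)
Definition lo_gap (v : value) (z : int) : int :=
  if is_node v then
    (if z <= to_int (apply1 Snd v) then to_int (apply1 Snd v) - z else 0)
  else (if to_int v <= 0 then 0 else 1).

Definition up_gap (v : value) (z : int) : int :=
  if is_node v then
    (if to_int (apply1 Snd v) <= z then z - to_int (apply1 Snd v) else 0)
  else (if 0 <= to_int v then 0 else 1).

Lemma ptime_lo_gap (v : G -> value) (z : G -> int) : ptime v -> ptime (fun x => Leaf (z x)) ->
  ptime (fun x => Leaf (lo_gap (v x) (z x))).
Proof.
move=> cv cz; have ca := ptime_to_int (ptime_op1 Snd cv).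
apply: (ptime_ifz (ptime_is_node cv)).
  apply: (ptime_ifz (ptime_le cz ca)); [exact: (ptime_sub ca cz) | exact: (ptime_int _ 0)].
apply: (ptime_ifz (ptime_le (ptime_to_int cv) (ptime_int _ 0))); exact: ptime_int.
Qed.

Lemma ptime_up_gap (v : G -> value) (z : G -> int) : ptime v -> ptime (fun x => Leaf (z x)) ->
  ptime (fun x => Leaf (up_gap (v x) (z x))).
Proof.
move=> cv cz; have ca := ptime_to_int (ptime_op1 Snd cv).
apply: (ptime_ifz (ptime_is_node cv)).
  apply: (ptime_ifz (ptime_le ca cz)); [exact: (ptime_sub cz ca) | exact: (ptime_int _ 0)].
apply: (ptime_ifz (ptime_le (ptime_int _ 0) (ptime_to_int cv))); exact: ptime_int.
Qed.

Lemma ptime_table (tbl : seq int) (k : G -> nat) : ptime (fun x => Leaf (k x)) ->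
  ptime (fun x => Leaf (nth 0 tbl (k x))).
Proof.
move=> ck; have := ptime_nth (ptime_const G (enc_list (map Leaf tbl))) ck.
apply: ptime_eq => x; case: (ltnP (k x) (size tbl)) => h.
  by rewrite (nth_map 0).
by rewrite !nth_default ?size_map.
Qed.

End Bounds.

Section Violation.
Variables (r s t : nat) (A : 'M[int]_(r + s, t)).

(** The fixed matrix A is stored as one row-major list of constants. *)
Definition mat_entry (i c : nat) : int :=
  nth 0 (mkseq (fun k => if insub (k %/ t)%N is Some i' then
                   if insub (k %% t)%N is Some c' then A i' c' else 0 else 0)
          ((r + s) * t)) (i * t + c).

Lemma mat_entryE (i : 'I_(r + s)) (c : 'I_t) : mat_entry i c = A i c.
Proof.
have t0 : (0 < t)%N by case: c => c /=; lia.
rewrite /mat_entry nth_mkseq; last first.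
  apply: (@leq_trans (i.+1 * t)); first by rewrite mulSn addnC ltn_add2r.
  by rewrite leq_mul2r ltn_ord orbT.
by rewrite divnMDl // modnMDl divn_small // modn_small // addn0 !valK.
Qed.

Section Def.
Variables (n : nat) (l u : 'cV[\bar int]_(n * t)) (b : 'cV[int]_(r + n * s)).
Variable z : 'cV[int]_(n * t).

(** Component [i] of b minus the n-fold matrix times z, for a linking row; entry
    [c] of brick [j] is entry [j * t + c] of [z]. *)
Definition top_res (i : nat) : int :=
  ent b i - \sum_(0 <= j < n) \sum_(0 <= c < t) mat_entry i c * ent z (j * t + c).

(** The same for row [i] of the j-th diagonal block. *)
Definition brick_res (j i : nat) : int :=
  ent b (r + (j * s + i)) - \sum_(0 <= c < t) mat_entry (r + i) c * ent z (j * t + c).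

Definition bound_gap (k : nat) : int :=
  lo_gap (eent l k) (ent z k) + up_gap (eent u k) (ent z k).

(** The 1-norm of b - M z plus the distance of z to the box, M being the n-fold
    product: it vanishes exactly on the feasible set, see [viol_eq0]. *)
Definition viol : int :=
  \sum_(0 <= i < r) `|top_res i| +
  \sum_(0 <= j < n) \sum_(0 <= i < s) `|brick_res j i| +
  \sum_(0 <= k < n * t) bound_gap k.

End Def.

Lemma ptime_dot (G : ctx) (N : G -> nat) (z : forall x, 'cV[int]_(N x)) (i j : G -> nat) :
  ptime (fun x => enc_vec (z x)) -> ptime (fun x => Leaf (i x)) -> ptime (fun x => Leaf (j x)) ->
  ptime (fun x => Leaf (\sum_(0 <= c < t) mat_entry (i x) c * ent (z x) (j x * t + c))).
Proof.
move=> cz ci cj.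
apply: (@ptime_sum _ (fun=> t) (fun x c => mat_entry (i x) c * ent (z x) (j x * t + c))).
- exact: (ptime_int _ t).
- exact: pbounded_const.
apply: ptime_mul.
  apply: ptime_table; apply: ptime_addn (ptime_topn G).
  by apply: ptime_muln (ptime_wn ci) _; exact: (ptime_int _ t).
apply: (@ptime_ent _ (fun p : extn G => N (tag p)) (fun p : extn G => z (tag p))).
  exact: (ptime_wn cz).
apply: ptime_addn (ptime_topn G); apply: ptime_muln (ptime_wn cj) _; exact: (ptime_int _ t).
Qed.

Section Comp.
Variables (G : ctx) (n : G -> nat).
Variables (l u : forall x, 'cV[\bar int]_(n x * t)) (b : forall x, 'cV[int]_(r + n x * s)).
Variable z : forall x, 'cV[int]_(n x * t).
Hypotheses (cn : ptime (fun x => Leaf (n x))) (pn : pbounded n).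
Hypotheses (cl : ptime (fun x => enc_evec (l x))) (cu : ptime (fun x => enc_evec (u x))).
Hypotheses (cb : ptime (fun x => enc_vec (b x))) (cz : ptime (fun x => enc_vec (z x))).

Lemma ptime_viol : ptime (fun x => Leaf (viol (l x) (u x) (b x) (z x))).
Proof.
apply: ptime_add; first apply: ptime_add.
- apply: (@ptime_sum _ (fun=> r) (fun x i => `|top_res (b x) (z x) i|)).
  + exact: (ptime_int _ r).
  + exact: pbounded_const.
  apply: ptime_abs; apply: ptime_sub.
    apply: (@ptime_ent _ _ (fun p : extn G => b (tag p))); first exact: (ptime_wn cb).
    exact: ptime_topn.
  apply: (@ptime_sum _ (fun p : extn G => n (tag p)) (fun p j =>
    \sum_(0 <= c < t) mat_entry (tagged p) c * ent (z (tag p)) (j * t + c))).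
  + exact: (ptime_wn cn).
  + exact: pbounded_wn.
  apply: (@ptime_dot _ _ (fun p : extn (extn G) => z (tag (tag p)))
            (fun p => tagged (tag p)) (fun p => tagged p)).
  + exact: (ptime_wn (ptime_wn cz)).
  + exact: (ptime_wn (ptime_topn G)).
  exact: ptime_topn.
- apply: (@ptime_sum _ n (fun x j => \sum_(0 <= i < s) `|brick_res (b x) (z x) j i|)) => //.
  apply: (@ptime_sum _ (fun=> s) (fun (p : extn G) i => `|brick_res (b (tag p)) (z (tag p))
    (tagged p) i|)).
  + exact: (ptime_int _ s).
  + exact: pbounded_const.
  have ci := ptime_topn (extn G); have cj := ptime_wn (ptime_topn G).
  apply: ptime_abs; apply: ptime_sub.
    apply: (@ptime_ent _ _ (fun p : extn (extn G) => b (tag (tag p)))).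
      exact: (ptime_wn (ptime_wn cb)).
    apply: ptime_addn; first exact: (ptime_int _ r).
    apply: ptime_addn ci; apply: ptime_muln cj _; exact: (ptime_int _ s).
  apply: (@ptime_dot _ _ (fun p : extn (extn G) => z (tag (tag p)))
            (fun p => r + tagged p)%N (fun p => tagged (tag p))) => //.
  + exact: (ptime_wn (ptime_wn cz)).
  by apply: ptime_addn ci; exact: (ptime_int _ r).
apply: (@ptime_sum _ (fun x => n x * t)%N (fun x k => bound_gap (l x) (u x) (z x) k)).
- by apply: ptime_muln => //; exact: (ptime_int _ t).
- by poly_bound.
have ce : ptime (fun p : extn G => Leaf (ent (z (tag p)) (tagged p))).
  apply: (@ptime_ent _ _ (fun p : extn G => z (tag p))); first exact: (ptime_wn cz).
  exact: ptime_topn.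
apply: ptime_add.
  apply: ptime_lo_gap ce; apply: (@ptime_eent _ _ (fun p : extn G => l (tag p))).
    exact: (ptime_wn cl).
  exact: ptime_topn.
apply: ptime_up_gap ce; apply: (@ptime_eent _ _ (fun p : extn G => u (tag p))).
  exact: (ptime_wn cu).
exact: ptime_topn.
Qed.
End Comp.
End Violation.

(** * Scanning all short directions and all steps 2^k *)

(** The j-th coordinate of the signed unit vector numbered [c]: e_c for [c < N],
    minus e_(c - N) for [N <= c < 2N], and the zero vector for [c = 2N]. *)
Definition unit_dir (N c j : nat) : int :=
  (if c == j then 1 else 0) - (if c == (N + j)%N then 1 else 0).

(** The j-th coordinate of the direction numbered [q]: the sum of the signed unit
    vectors given by the [g] digits of [q] in base 2N + 1.  These are the vectors
    of 1-norm at most [g], see [dvec_surj]; repetitions do no harm. *)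
Fixpoint dir (N g q j : nat) : int :=
  if g is g'.+1 then
    unit_dir N (q %% (2 * N + 1)) j + dir N g' (q %/ (2 * N + 1)) j
  else 0.

Definition ndir (N g : nat) : nat := ((2 * N + 1) ^ g)%N.

Section Scan.
Variables (N g L : nat).
Variable better : 'cV[int]_N -> 'cV[int]_N -> bool.

Definition cand (z : 'cV[int]_N) (k q : nat) : 'cV[int]_N :=
  \col_(j < N) (ent z j + (2 ^ k)%N%:Z * dir N g q j).

(** The number [p] encodes direction and exponent.  The minimum matters only for
    [p] beyond the range of the scan: it keeps [2 ^ k] of polynomial bit length for
    every index. *)
Definition keep_better (z b : 'cV[int]_N) (p : nat) : 'cV[int]_N :=
  let c := cand z (minn (p %/ ndir N g) L) (p %% ndir N g) in
  if better b c then c else b.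

Definition scan (z : 'cV[int]_N) : 'cV[int]_N :=
  iteri (ndir N g * L) (fun p b => keep_better z b p) z.

End Scan.

Lemma abs_unit_dir N c j : (`|unit_dir N c j| <= 1)%N.
Proof. by rewrite /unit_dir; case: eqP; case: eqP. Qed.

Lemma abs_dir N g q j : (`|dir N g q j| <= g)%N.
Proof.
elim: g q => //= g IH q; have h1 := abs_unit_dir N (q %% (2 * N + 1)) j.
have h2 := IH (q %/ (2 * N + 1))%N; lia.
Qed.

Lemma abs_scan N g L better (z : 'cV[int]_N) i :
  (`|scan g L better z i 0%R| <= `|z i 0%R| + 2 ^ L * g)%N.
Proof.
rewrite /scan; elim: (_ * _)%N => [|p IH] /=; first by rewrite leq_addr.
rewrite {1}/keep_better; case: ifP => // _; rewrite mxE entE.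
have h1 := abs_dir N g (p %% ndir N g) i.
have h2 : (2 ^ minn (p %/ ndir N g) L <= 2 ^ L)%N by rewrite leq_exp2l // geq_minr.
have h3 := leq_mul h2 h1; lia.
Qed.

(** A round moves every coordinate by at most 2^L g, so polynomially many rounds
    add polynomially many bits. *)
Lemma abs_iter_scan N g L better (z : 'cV[int]_N) j i :
  (`|iter j (scan g L better) z i 0%R| <= `|z i 0%R| + j * (2 ^ L * g))%N.
Proof.
elim: j => [|j IH] /=; first by rewrite leq_addr.
by apply: leq_trans (abs_scan _ _ _ _ _) _; rewrite mulSn; lia.
Qed.

Lemma vsize_enc_vec N (z : 'cV[int]_N) :
  vsize (enc_vec z) = (\sum_i (bitlen (z i 0%R)).+1 + 1)%N.
Proof. by rewrite /enc_vec vsize_enc_list big_map big_enum. Qed.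

Lemma vsize_enc_vec_le N (z : 'cV[int]_N) B :
  (forall i, (`|z i 0%R| < 2 ^ B)%N) -> (vsize (enc_vec z) <= N * B.+2 + 1)%N.
Proof.
move=> h; rewrite vsize_enc_vec leq_add2r -sum_const_ord.
by apply: leq_sum => i _; rewrite ltnS; exact: bitlen_leq.
Qed.

Lemma bitlen_vsize N (z : 'cV[int]_N) i : (bitlen (z i 0%R) <= vsize (enc_vec z))%N.
Proof. by rewrite vsize_enc_vec (bigD1 i) //=; lia. Qed.

Section CompScan.
Variable g : nat.

Lemma ptime_dir (G : ctx) (N q j : G -> nat) :
  ptime (fun x => Leaf (N x)) -> ptime (fun x => Leaf (q x)) -> ptime (fun x => Leaf (j x)) ->
  ptime (fun x => Leaf (dir (N x) g (q x) (j x))).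
Proof.
move=> cN cq cj; elim: g q cq => [|g' IH] q cq; first exact: (ptime_int _ 0).
have cB : ptime (fun x => Leaf (2 * N x + 1)%N).
  by apply: ptime_addn (ptime_int _ 1); apply: ptime_muln cN; exact: (ptime_int _ 2).
apply: ptime_add; last exact: (IH _ (ptime_divn cq cB)).
have cm := ptime_modn cq cB.
apply: ptime_sub.
  exact: (ptime_ifz (ptime_eqn cm cj) (ptime_int _ 1) (ptime_int _ 0)).
exact: (ptime_ifz (ptime_eqn cm (ptime_addn cN cj)) (ptime_int _ 1) (ptime_int _ 0)).
Qed.

Lemma ptime_ndir (G : ctx) (N : G -> nat) : ptime (fun x => Leaf (N x)) ->
  ptime (fun x => Leaf (ndir (N x) g)).
Proof.
move=> cN; apply: ptime_expn; apply: ptime_addn (ptime_int _ 1).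
apply: ptime_muln cN; exact: (ptime_int _ 2).
Qed.

Lemma ptime_cand (G : ctx) (N k q : G -> nat) (z : forall x, 'cV[int]_(N x)) :
  ptime (fun x => Leaf (N x)) -> pbounded N -> ptime (fun x => Leaf (k x)) -> pbounded k ->
  ptime (fun x => Leaf (q x)) -> ptime (fun x => enc_vec (z x)) ->
  ptime (fun x => enc_vec (cand g (z x) (k x) (q x))).
Proof.
move=> cN pN ck pk cq cz.
apply: (@ptime_col _ N (fun x j => ent (z x) j + (2 ^ k x)%N%:Z * dir (N x) g (q x) j)) => //.
apply: ptime_add.
  apply: (@ptime_ent _ _ (fun p : extn G => z (tag p))); first exact: (ptime_wn cz).
  exact: ptime_topn.
apply: ptime_mul; first exact: (ptime_wn (ptime_pow2 ck pk)).
apply: (@ptime_dir _ (fun p : extn G => N (tag p)) (fun p => q (tag p)) (fun p => tagged p)).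
- exact: (ptime_wn cN).
- exact: (ptime_wn cq).
exact: ptime_topn.
Qed.

Variables (G : ctx) (N L : G -> nat).
Hypotheses (cN : ptime (fun x => Leaf (N x))) (pN : pbounded N).
Hypotheses (cL : ptime (fun x => Leaf (L x))) (pL : pbounded L).

Definition vec_ext := ext (fun (x : G) (z : 'cV[int]_(N x)) => enc_vec z).
Definition vec_ext2 :=
  @ext vec_ext (fun p => 'cV[int]_(N (tag p))) (fun p z => enc_vec z).

Variable better : forall x, 'cV[int]_(N x) -> 'cV[int]_(N x) -> bool.
Arguments better : clear implicits.
Hypothesis cbetter : ptime (fun p : vec_ext2 =>
  of_bool (better (tag (tag p)) (tagged (tag p)) (tagged p))).

Lemma ptime_better (H : ctx) (phi : H -> G) (z1 z2 : forall x, 'cV[int]_(N (phi x))) :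
  (forall x, orc (phi x) = orc x) -> pbounded (fun x => sz (phi x)) ->
  ptime (fun x => inp (phi x)) ->
  ptime (fun x => enc_vec (z1 x)) -> ptime (fun x => enc_vec (z2 x)) ->
  ptime (fun x => of_bool (better (phi x) (z1 x) (z2 x))).
Proof.
move=> ho hs hi c1 c2.
pose psi x : vec_ext2 := existT _ (existT _ (phi x) (z1 x)) (z2 x).
apply: (@ptime_subst H vec_ext2 psi) cbetter => //.
by apply: ptime_node => //; apply: ptime_node.
Qed.

Lemma ptime_scan : ptime (fun p : vec_ext =>
  enc_vec (scan g (L (tag p)) (better (tag p)) (tagged p))).
Proof.
pose eA (p : vec_ext) (b : 'cV[int]_(N (tag p))) := enc_vec b.
pose eV (x : G) (z : 'cV[int]_(N x)) := enc_vec z.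
have wk o : ptime o -> ptime (fun p : vec_ext => o (tag p)) := @ptime_weak _ _ eV o.
have pwk q : pbounded q -> pbounded (fun p : vec_ext => q (tag p)) := @pbounded_weak _ _ eV q.
have cN1 := wk _ cN; have pN1 := pwk _ pN.
have cL1 := wk _ cL; have pL1 := pwk _ pL.
have cz1 : ptime (fun p : vec_ext => enc_vec (tagged p)) := ptime_top eV.
have cQ1 := ptime_ndir cN1.
have ccand : ptime (fun p : extn vec_ext =>
    let x := tag (tag p) in
    enc_vec (cand g (tagged (tag p)) (minn (tagged p %/ ndir (N x) g) (L x))
      (tagged p %% ndir (N x) g))).
  have ck := ptime_divn (ptime_topn vec_ext) (ptime_wn cQ1).
  apply: (@ptime_cand (extn vec_ext) (fun p => N (tag (tag p)))
    (fun p => minn (tagged p %/ ndir (N (tag (tag p))) g) (L (tag (tag p))))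
    (fun p => tagged p %% ndir (N (tag (tag p))) g)%N (fun p => tagged (tag p))).
  - exact: (ptime_wn cN1).
  - exact: (pbounded_wn pN1).
  - apply: (ptime_eq _ (ptime_subn ck (ptime_subn ck (ptime_wn cL1)))) => p.
    by rewrite minnE.
  - by apply: (pbounded_le (pbounded_wn pL1)) => p; rewrite geq_minr.
  - exact: (ptime_modn (ptime_topn vec_ext) (ptime_wn cQ1)).
  exact: (ptime_wn cz1).
have pQL : pbounded (fun p : vec_ext => ndir (N (tag p)) g * L (tag p))%N.
  by rewrite /ndir; poly_bound.
have [S pS hS] := pbounded_extn (pbounded_vsize ccand) pQL.
have pz := pbounded_vsize cz1.
apply: (@ptime_for vec_ext _ eA (fun p => tagged p)
  (fun p j b => keep_better g (L (tag p)) (better (tag p)) (tagged p) b j)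
  (fun p => ndir (N (tag p)) g * L (tag p))%N
  (fun p => vsize (enc_vec (tagged p)) + S p)%N) => //.
- by apply: ptime_muln.
- have cc := ptime_weakn eA ccand.
  apply: (ptime_eq _ (ptime_if (c := fun p : ext2 eA =>
     better (tag (tag (tag p))) (tagged p)
       (cand g (tagged (tag (tag p)))
          (minn (tagged (tag p) %/ ndir (N (tag (tag (tag p)))) g) (L (tag (tag (tag p)))))
          (tagged (tag p) %% ndir (N (tag (tag (tag p)))) g))) _ cc (ptime_top2 eA))).
    by move=> p /=; rewrite /keep_better /eA; case: ifP.
  apply: (@ptime_better (ext2 eA) (fun p => tag (tag (tag p))) (fun p => tagged p)
    (fun p => cand g (tagged (tag (tag p)))
          (minn (tagged (tag p) %/ ndir (N (tag (tag (tag p)))) g) (L (tag (tag (tag p)))))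
          (tagged (tag p) %% ndir (N (tag (tag (tag p)))) g))) => //.
  + exact: (@pbounded_sz (ext2 eA)).
  + exact: (ptime_weak2 eA (wk _ (@ptime_inp G))).
  exact: (ptime_top2 eA).
- by poly_bound.
move=> p; elim=> [|j IH] le; first by rewrite /eA /=; lia.
rewrite /= {1}/keep_better; case: ifP => _; last exact: IH (ltnW le).
by apply: leq_trans (hS p j (ltnW le)) _; rewrite leq_addl.
Qed.

Variable a0 : forall x, 'cV[int]_(N x).
Arguments a0 : clear implicits.
Hypothesis c0 : ptime (fun x => enc_vec (a0 x)).
Variable M : G -> nat.
Hypothesis pM : pbounded M.
Let st x := scan g (L x) (better x).
Let tst x z := better x z (st z).
Hypothesis run : forall x j, (j < M x)%N -> tst (iter j (@st x) (a0 x)).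
Hypothesis stop : forall x, ~~ tst (iter (M x) (@st x) (a0 x)).

(** Repeating the scan while it improves is polynomial as soon as the number of
    rounds is. *)
Lemma ptime_descent : ptime (fun x => enc_vec (iter (M x) (@st x) (a0 x))).
Proof.
pose S x := (N x * (vsize (enc_vec (a0 x)) + (M x + L x + g) + 5) + 1)%N.
have pa := pbounded_vsize c0.
pose eV (x : G) (z : 'cV[int]_(N x)) := enc_vec z.
apply: (@ptime_while G _ eV a0 (fun x => @st x) (fun x => @tst x) M S) => //.
- apply: (@ptime_better vec_ext tag (fun p => tagged p) (fun p => st (tagged p))) => //.
  + exact: (@pbounded_sz vec_ext).
  + exact: (ptime_weak eV (@ptime_inp G)).
  + exact: (ptime_top eV).
  exact: ptime_scan.
- exact: ptime_scan.
- by rewrite /S; poly_bound.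
move=> x j le; rewrite /eV.
apply: leq_trans (_ : _ <= N x * (vsize (enc_vec (a0 x)) + (M x + L x + g)).+3.+2 + 1)%N _.
  apply: vsize_enc_vec_le => i.
  apply: leq_ltn_trans (abs_iter_scan _ _ _ _ _ _) _.
  set V := vsize _; have h1 : (`|a0 x i 0%R| < 2 ^ V)%N.
    apply: leq_trans (ltn_bitlen _) _; rewrite leq_exp2l //.
    by apply: leq_trans (leq_pred _) (bitlen_vsize _ _).
  have h2 : (j * (2 ^ L x * g) <= 2 ^ (M x + L x + g))%N.
    rewrite !expnD -mulnA; apply: leq_mul; last first.
      by rewrite leq_mul2l (ltnW (ltn_expl _ _)) // orbT.
    exact: leq_trans le (ltnW (ltn_expl _ _)).
  have h3 : (2 ^ V <= 2 ^ (V + (M x + L x + g)))%N by rewrite leq_exp2l // leq_addr.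
  have h4 : (2 ^ (M x + L x + g) <= 2 ^ (V + (M x + L x + g)))%N.
    by rewrite leq_exp2l // leq_addl.
  rewrite !expnS; lia.
by rewrite /S leq_add2r; apply: leq_mul => //; lia.
Qed.
End CompScan.

(** * Dickson's lemma and conformal decompositions *)

(** Dickson's lemma for the coordinates in [S], by induction on their number.  Fix
    [p] in [P]; a [w] that does not dominate [p] has [c i w = a] for some
    coordinate [i] and some [a < c i p].  There are finitely many such pairs, and
    on the part of [P] belonging to one of them coordinate [i] is constant and can
    be dropped. *)
Lemma dickson_on (T : eqType) (I : finType) (c : I -> T -> nat) m (S : {set I}) :
  (#|S| <= m)%N -> forall P : T -> Prop, exists V : seq T,
    (forall v, v \in V -> P v) /\
    forall w, P w -> exists2 v, v \in V & forall i, i \in S -> (c i v <= c i w)%N.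
Proof.
elim: m S => [|m IH] S le P.
  have S0 : S = finset.set0 by apply/eqP; rewrite -cards_eq0 -leqn0.
  have [[p Pp]|nP] := pselect (exists p, P p); last first.
    by exists [::]; split=> // w Pw; case: nP; exists w.
  exists [:: p]; split=> [v|w _]; first by rewrite inE => /eqP ->.
  by exists p; rewrite ?inE // S0 => i; rewrite inE.
have [[p Pp]|nP] := pselect (exists p, P p); last first.
  by exists [::]; split=> // w Pw; case: nP; exists w.
have h i a : exists V : seq T, i \in S -> (forall v, v \in V -> P v /\ c i v = a) /\
    forall w, P w -> c i w = a ->
      exists2 v, v \in V & forall k, k \in S -> (c k v <= c k w)%N.
  have [iS|niS] := boolP (i \in S); last by exists [::].
  have [|V [h1 h2]] := IH (S :\ i)%SET _ (fun w => P w /\ c i w = a).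
    by move: le; rewrite (cardsD1 i) iS.
  exists V => _; split=> // w Pw wa; have [v vV hv] := h2 w (conj Pw wa).
  exists v => // k kS; have [->|ki] := eqVneq k i; last by apply: hv; rewrite !inE ki.
  by have [_ ->] := h1 v vV; rewrite wa.
have [V hV] := choice (fun ia : I * nat => h ia.1 ia.2).
pose W := p :: flatten [seq flatten [seq V (i, a) | a <- iota 0 (c i p)] | i <- enum S].
exists W; split=> [v|w Pw].
  rewrite inE => /orP[/eqP -> //|/flattenP[s /mapP[i]]].
  rewrite mem_enum => iS -> /flattenP[s' /mapP[a _ ->] vV].
  by have [/(_ v vV)[]] := hV (i, a) iS.
have [/forallP hall|] := boolP [forall i, (i \in S) ==> (c i p <= c i w)%N].
  by exists p; rewrite ?inE ?eqxx // => i iS; have /implyP/(_ iS) := hall i.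
rewrite negb_forall => /existsP[i]; rewrite negb_imply -ltnNge => /andP[iS lt].
have [_ /(_ w Pw erefl)[v vV hv]] := hV (i, c i w) iS; exists v => //.
rewrite inE; apply/orP; right; apply/flattenP.
exists (flatten [seq V (i, a) | a <- iota 0 (c i p)]).
  by apply/mapP; exists i; rewrite ?mem_enum.
by apply/flattenP; exists (V (i, c i w)) => //; apply/mapP; exists (c i w); rewrite ?mem_iota.
Qed.

Lemma dickson (T : eqType) (I : finType) (c : I -> T -> nat) (P : T -> Prop) :
  exists V : seq T, (forall v, v \in V -> P v) /\
    forall w, P w -> exists2 v, v \in V & forall i, (c i v <= c i w)%N.
Proof.
have [V [h1 h2]] := dickson_on c (leqnn #|[set: I]|) P.
by exists V; split=> // w /h2[v vV h]; exists v => // i; apply: h; rewrite inE.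
Qed.

(** The conformal order on integers: [a] lies between 0 and [b].  It is the
    componentwise order of positive and negative parts, which is what makes
    Dickson's lemma applicable. *)
Definition cle (a b : int) : bool := (0 <= a <= b) || (b <= a <= 0).

Definition pos_part (a : int) : nat := if 0 <= a then `|a|%N else 0%N.
Definition neg_part (a : int) : nat := if 0 <= a then 0%N else `|a|%N.

Lemma cle_parts a b : (pos_part a <= pos_part b)%N -> (neg_part a <= neg_part b)%N -> cle a b.
Proof. by rewrite /pos_part /neg_part /cle; do 2 case: ifP => ?; lia. Qed.

Lemma cle_trans a b c : cle a b -> cle b c -> cle a c.
Proof. rewrite /cle; lia. Qed.

Lemma cle_subr a b : cle a b -> cle (b - a) b.
Proof. rewrite /cle; lia. Qed.

Section Conformal.
Variables (m k : nat) (M : 'M[int]_(m, k)).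
Implicit Types u v w : 'cV[int]_k.

Definition conformal u w : Prop :=
  (forall i, cle (u i 0) (w i 0)) /\ (forall i, cle ((M *m u) i 0) ((M *m w) i 0)).

Definition norm1 w : nat := (\sum_i `|w i 0%R|)%N.

Lemma norm1_gt0 w : w != 0 -> (0 < norm1 w)%N.
Proof.
apply: contra_neqT; rewrite -leqNgt leqn0 sum_nat_eq0 => /forallP h.
by apply/colP => i; rewrite mxE; have := h i; rewrite /= absz_eq0 => /eqP.
Qed.

Lemma norm1_conformal u w : conformal u w -> (norm1 w = norm1 u + norm1 (w - u))%N.
Proof.
case=> h _; rewrite /norm1 -big_split /=; apply: eq_bigr => i _.
have := h i; rewrite !mxE /cle; move: (u i 0) (w i 0) => a b; lia.
Qed.

Lemma conformal_finite_basis : exists V : seq 'cV[int]_k,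
  (forall v, v \in V -> v != 0) /\
  forall w, w != 0 -> exists2 v, v \in V & conformal v w.
Proof.
pose c (x : ('I_k + 'I_m) * bool) w : nat :=
  let a := match x.1 with inl i => w i 0 | inr i => (M *m w) i 0 end in
  if x.2 then pos_part a else neg_part a.
have [V [h1 h2]] := dickson c (fun w => w != 0).
exists V; split=> // w /h2[v vV h]; exists v => //; split=> i; apply: cle_parts.
- exact: (h (inl i, true)).
- exact: (h (inl i, false)).
- exact: (h (inr i, true)).
- exact: (h (inr i, false)).
Qed.

Lemma conformal_trans u v w : conformal u v -> conformal v w -> conformal u w.
Proof.
by case=> h1 h2 [h3 h4]; split=> i; [move: (h1 i) (h3 i)|move: (h2 i) (h4 i)]; exact: cle_trans.
Qed.

Lemma conformal_subr u w : conformal u w -> conformal (w - u) w.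
Proof.
case=> h1 h2; split=> i; first by rewrite !mxE; exact: cle_subr.
rewrite mulmxBr [X in cle X]mxE [X in cle (_ + X)]mxE; exact: cle_subr.
Qed.

(** A conformal summand can be split off without leaving the orthant of [w], and
    what remains has smaller 1-norm. *)
Lemma conformal_decomp (I : finType) (v : I -> 'cV[int]_k) :
  (forall w, w != 0 -> exists2 i, v i != 0 & conformal (v i) w) ->
  forall w, exists mu : I -> nat, w = \sum_i v i *+ mu i /\
    forall i, (0 < mu i)%N -> v i != 0 /\ conformal (v i) w.
Proof.
move=> hv w; have [p] := ubnP (norm1 w); elim: p w => // p IH w le.
have [->|w0] := eqVneq w 0.
  by exists (fun=> 0%N); split=> //; rewrite big1.
have [i vi0 ci] := hv w w0.
have [|mu [e h]] := IH (w - v i).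
  by have := norm1_conformal ci; have := norm1_gt0 vi0; lia.
exists (fun j => mu j + (j == i))%N; split.
  under eq_bigr do rewrite mulrnDr.
  rewrite big_split /= -e (bigD1 i) //= eqxx big1 ?addr0 ?subrK // => j /negPf ->.
  by [].
move=> j; have [->|ji] := eqVneq j i; first by [].
rewrite addn0 => /h[nz cj]; split=> //; apply: conformal_trans cj _; exact: conformal_subr.
Qed.

End Conformal.

(** * The bricks of the n-fold product *)

Section Index.
Variables (n t : nat).

Lemma flat_lt (j : 'I_n) (c : 'I_t) : (j * t + c < n * t)%N.
Proof.
apply: (@leq_trans (j.+1 * t)); first by rewrite mulSn addnC ltn_add2r.
by rewrite leq_mul2r ltn_ord orbT.
Qed.

(** The position of entry [c] of brick [j] in a vector of length [n * t]. *)
Definition flat (j : 'I_n) (c : 'I_t) : 'I_(n * t) := Ordinal (flat_lt j c).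

Lemma div_flat (j c : nat) : (c < t)%N -> ((j * t + c) %/ t = j)%N.
Proof. by move=> h; rewrite divnMDl ?divn_small ?addn0 //; case: t h. Qed.

Lemma mod_flat (j c : nat) : (c < t)%N -> ((j * t + c) %% t = c)%N.
Proof. by move=> h; rewrite modnMDl modn_small. Qed.

Lemma flat_surj (k : 'I_(n * t)) : exists j c, k = flat j c.
Proof.
have t0 : (0 < t)%N by case: t k => [|//] [k]; rewrite muln0.
have lt1 : (k %/ t < n)%N by rewrite ltn_divLR.
have lt2 : (k %% t < t)%N by rewrite ltn_pmod.
by exists (Ordinal lt1), (Ordinal lt2); apply: val_inj => /=; rewrite -divn_eq.
Qed.

Lemma flat_inj : injective (fun p : 'I_n * 'I_t => flat p.1 p.2).
Proof.
move=> [j c] [j' c'] /(congr1 (@nat_of_ord _)) /= e; congr pair; apply: val_inj.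
  by rewrite /= -(div_flat j (ltn_ord c)) e div_flat.
by rewrite /= -(mod_flat j (ltn_ord c)) e mod_flat.
Qed.

Lemma sum_flat (V : nmodType) (F : 'I_(n * t) -> V) :
  \sum_k F k = \sum_(j < n) \sum_(c < t) F (flat j c).
Proof.
rewrite pair_bigA /= (reindex (fun p : 'I_n * 'I_t => flat p.1 p.2)) //=.
apply: onW_bij; apply: inj_card_bij; first exact: flat_inj.
by rewrite card_prod !card_ord.
Qed.

(** The block matrices of the n-fold product are indexed by sums of block sizes;
    for blocks of equal size their decoding is division with remainder. *)
Lemma sig_flat (k : 'I_(\sum_(i < n) t)) (j : 'I_n) (c : 'I_t) :
  k = (j * t + c)%N :> nat -> tagnat.sig1 k = j /\ tagnat.sig2 k = c.
Proof.
have e := tagnat.rect k.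
have e1 : (\sum_(i < n | (i < tagnat.sig1 k)%N) t = tagnat.sig1 k * t)%N.
  rewrite -(big_ord_widen n (fun=> t) (ltnW (ltn_ord (tagnat.sig1 k)))).
  exact: sum_const_ord.
move: e; rewrite e1 => e e'; have h := e; rewrite e' in h.
split; apply: val_inj => /=.
  by rewrite -(div_flat j (ltn_ord c)) h div_flat.
by rewrite -(mod_flat j (ltn_ord c)) h mod_flat.
Qed.

End Index.

Section Nfold.
Variables (r s t : nat) (A : 'M[int]_(r + s, t)) (n : nat).

Lemma nfold_top (i : 'I_r) (j : 'I_n) (c : 'I_t) :
  nfold A n (lshift (n * s) i) (flat j c) = A (lshift s i) c.
Proof.
rewrite castmxE /=.
have -> : cast_ord (esym (congr1 (addn r) (sum_const_ord n s))) (lshift (n * s) i)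
        = lshift _ i by apply: val_inj.
rewrite col_mxEu mxE mxE.
by have [_ ->] := @sig_flat n t (cast_ord (esym (sum_const_ord n t)) (flat j c)) j c erefl.
Qed.

Lemma nfold_brick (i : 'I_s) (j' : 'I_n) (j : 'I_n) (c : 'I_t) :
  nfold A n (rshift r (flat j' i)) (flat j c) = if j' == j then A (rshift r i) c else 0.
Proof.
rewrite castmxE /=.
have -> : cast_ord (esym (congr1 (addn r) (sum_const_ord n s))) (rshift r (flat j' i))
        = rshift r (cast_ord (esym (sum_const_ord n s)) (flat j' i)) by apply: val_inj.
rewrite col_mxEd mxE.
have [e1 e2] := @sig_flat n t (cast_ord (esym (sum_const_ord n t)) (flat j c)) j c erefl.
have [e3 e4] := @sig_flat n s (cast_ord (esym (sum_const_ord n s)) (flat j' i)) j' i erefl.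
by rewrite e1 e2 e3 e4; case: eqP => _; rewrite !mxE.
Qed.

Definition brick (x : 'cV[int]_(n * t)) (j : 'I_n) : 'cV[int]_t :=
  \col_c x (flat j c) 0.

Lemma nfold_mul_top (x : 'cV[int]_(n * t)) (i : 'I_r) :
  (nfold A n *m x) (lshift (n * s) i) 0 = (usubmx A *m \sum_j brick x j) i 0.
Proof.
rewrite mxE sum_flat mulmx_sumr summxE; apply: eq_bigr => j _.
by rewrite mxE; apply: eq_bigr => c _; rewrite nfold_top !mxE.
Qed.

Lemma nfold_mul_brick (x : 'cV[int]_(n * t)) (j : 'I_n) (i : 'I_s) :
  (nfold A n *m x) (rshift r (flat j i)) 0 = (dsubmx A *m brick x j) i 0.
Proof.
rewrite mxE sum_flat (bigD1 j) //= [X in _ + X]big1 ?addr0.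
  by rewrite mxE; apply: eq_bigr => c _; rewrite nfold_brick eqxx !mxE.
move=> j' /negPf jj'; rewrite big1 // => c _.
by rewrite nfold_brick eq_sym jj' mul0r.
Qed.

End Nfold.

(** * Short conformal directions for n-fold products *)

(** Passing to smaller multiplicities [mu0 <= mu] in a sum of terms of one sign
    gives a partial sum conformal to the total, without cancellation. *)
Section SignedSums.
Variables (I : finType) (v : I -> int) (W : int) (mu mu0 : I -> nat).
Hypothesis sgn : forall i, (0 < mu i)%N -> cle (v i) W.
Hypothesis sub : forall i, (mu0 i <= mu i)%N.

Lemma cle_sum : W = \sum_i v i *+ mu i -> cle (\sum_i v i *+ mu0 i) W.
Proof.
have [W0|W0] := lerP 0 W => WE; rewrite /cle.
  have v0 i : (0 < mu i)%N -> 0 <= v i by move=> /sgn; rewrite /cle; lia.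
  apply/orP; left; rewrite WE; apply/andP; split.
    apply: sumr_ge0 => i _; case: (posnP (mu i)) (sub i) => [->|/v0 h _].
      by rewrite leqn0 => /eqP ->.
    exact: mulrn_wge0.
  apply: ler_sum => i _; case: (posnP (mu i)) (sub i) => [->|/v0 h le].
    by rewrite leqn0 => /eqP ->.
  exact: ler_wpMn2l.
have v0 i : (0 < mu i)%N -> v i <= 0 by move=> /sgn; rewrite /cle; lia.
apply/orP; right; rewrite WE; apply/andP; split.
  apply: ler_sum => i _; case: (posnP (mu i)) (sub i) => [->|/v0 h le].
    by rewrite leqn0 => /eqP ->.
  exact: ler_wnMn2l.
apply: sumr_le0 => i _; case: (posnP (mu i)) (sub i) => [->|/v0 h _].
  by rewrite leqn0 => /eqP ->.
exact: mulrn_wle0.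
Qed.

Lemma abs_sum : `|(\sum_i v i *+ mu0 i)%R|%N = (\sum_i `|v i| * mu0 i)%N.
Proof.
have [W0|W0] := lerP 0 W.
  have E i : v i *+ mu0 i = (`|v i| * mu0 i)%N%:Z.
    case: (posnP (mu i)) (sub i) => [->|/sgn h _].
      by rewrite leqn0 => /eqP ->; rewrite muln0.
    rewrite -mulr_natr natz PoszM; congr (_ * _); move: h; rewrite /cle; lia.
  rewrite (eq_bigr _ (fun i _ => E i)).
  by rewrite -(big_morph Posz PoszD (erefl (Posz 0))) absz_nat.
have E i : v i *+ mu0 i = - (`|v i| * mu0 i)%N%:Z.
  case: (posnP (mu i)) (sub i) => [->|/sgn h _].
    by rewrite leqn0 => /eqP ->; rewrite muln0.
  rewrite -mulr_natr natz PoszM -mulNr; congr (_ * _); move: h; rewrite /cle; lia.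
rewrite (eq_bigr _ (fun i _ => E i)).
by rewrite sumrN abszN -(big_morph Posz PoszD (erefl (Posz 0))) absz_nat.
Qed.

End SignedSums.

Lemma mulmx_natr (m n p : nat) (B : 'M[int]_(m, n)) (C : 'M[int]_(n, p)) k :
  B *m (C *+ k) = (B *m C) *+ k.
Proof. by elim: k => [|k IH]; rewrite ?mulmx0 // !mulrS mulmxDr IH. Qed.

Lemma split_count (n : nat) (mu : 'I_n -> nat) (h : nat) : (h <= \sum_j mu j)%N ->
  exists nu : 'I_n -> nat, (forall j, (nu j <= mu j)%N) /\ (\sum_j nu j = h)%N.
Proof.
elim: n mu h => [|n IH] mu h; first by rewrite big_ord0 leqn0 => /eqP ->; exists mu;
  rewrite big_ord0.
rewrite big_ord_recl => le.
have [|nu [h1 h2]] := IH (fun j => mu (lift ord0 j)) (h - minn h (mu ord0))%N.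
  by move: le; rewrite /=; set X := (\sum_(i < n) _)%N; lia.
exists (fun j => if unlift ord0 j is Some j' then nu j' else minn h (mu ord0)); split.
  by move=> j; case: unliftP => [j'|] ->; rewrite ?h1 // geq_minr.
rewrite big_ord_recl unlift_none; under eq_bigr do rewrite liftK.
by rewrite h2; lia.
Qed.

Lemma unbrick (n t : nat) (F : 'I_n -> 'cV[int]_t) :
  exists d : 'cV[int]_(n * t), forall j, brick d j = F j.
Proof.
have h (k : 'I_(n * t)) : exists p : 'I_n * 'I_t, k = flat p.1 p.2.
  by have [j [c ->]] := flat_surj k; exists (j, c).
have [g gP] := choice h.
exists (\col_k F (g k).1 (g k).2 0) => j; apply/colP => c; rewrite !mxE.
by have -> : g (flat j c) = (j, c) by apply: flat_inj; rewrite -gP.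
Qed.

Lemma norm1_brick (n t : nat) (d : 'cV[int]_(n * t)) : (norm1 d = \sum_j norm1 (brick d j))%N.
Proof.
rewrite /norm1 sum_flat; apply: eq_bigr => j _; apply: eq_bigr => c _; by rewrite mxE.
Qed.

(** The bound on Graver complexity.  Dickson's lemma is used twice: for the
    diagonal block it yields the finite family [v] into which all bricks
    decompose; for the count vectors [h] of such decompositions, ordered by [h]
    itself and by the positive and negative parts of the linking rows, it yields
    finitely many [H], whose weights bound the norm. *)
Theorem graver_bound (r s t : nat) (A : 'M[int]_(r + s, t)) :
  exists g : nat, forall n (w : 'cV[int]_(n * t)), w != 0 ->
    exists d, [/\ d != 0, conformal (nfold A n) d w & (norm1 d <= g)%N].
Proof.
have [V [V0 VP]] := conformal_finite_basis (dsubmx A).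
pose m := size V; pose v (i : 'I_m) : 'cV[int]_t := nth 0 V i.
have v0 i : v i != 0 by apply: V0; rewrite mem_nth.
pose val1 (h : {ffun 'I_m -> nat}) := usubmx A *m \sum_i v i *+ h i.
pose c (x : 'I_m + 'I_r * bool) (h : {ffun 'I_m -> nat}) : nat :=
  match x with
  | inl i => h i
  | inr (i, true) => pos_part (val1 h i 0)
  | inr (i, false) => neg_part (val1 h i 0)
  end.
have [H [H0 HP]] := dickson c (fun h => exists i, (0 < h i)%N).
pose wt (h : {ffun 'I_m -> nat}) := (\sum_i h i * norm1 (v i))%N.
exists (\max_(h <- H) wt h)%N => n w w0.
have dec j : exists mu : 'I_m -> nat, brick w j = \sum_i v i *+ mu i /\
    forall i, (0 < mu i)%N -> v i != 0 /\ conformal (dsubmx A) (v i) (brick w j).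
  apply: conformal_decomp => x x0; have [y yV cy] := VP x x0.
  have ym : (index y V < m)%N by rewrite index_mem.
  by exists (Ordinal ym); rewrite ?v0 // /v /= nth_index.
have {dec}[mu muP] := choice dec.
pose h := [ffun i => \sum_j mu j i]%N.
have hpos : exists i, (0 < h i)%N.
  have /existsP[j] : [exists j, brick w j != 0].
    apply: contraNT w0; rewrite negb_exists => /forallP b0.
    apply/eqP/colP => k; have [j [cc ->]] := flat_surj k.
    have := b0 j; rewrite negbK => /eqP /colP /(_ cc); by rewrite !mxE.
  rewrite (muP j).1 => nz.
  have /existsP[i hi] : [exists i, (0 < mu j i)%N].
    apply: contraNT nz; rewrite negb_exists => /forallP h0.
    rewrite big1 // => i _; have := h0 i; rewrite lt0n negbK => /eqP ->.
    by rewrite mulr0n.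
  by exists i; rewrite ffunE (bigD1 j) //= addn_gt0 hi.
have [h0 h0H le0] := HP h hpos.
(* The counts h0 are distributed over the bricks of w, within mu. *)
have sel i : exists nu : 'I_n -> nat, (forall j, (nu j <= mu j i)%N) /\ (\sum_j nu j = h0 i)%N.
  by apply: split_count; have := le0 (inl i); rewrite /= ffunE.
have {sel}[nu nuP] := choice sel.
have [d dP] := unbrick (fun j => \sum_i v i *+ nu i j).
have nd j : norm1 (brick d j) = (\sum_i nu i j * norm1 (v i))%N.
  rewrite dP /norm1; under [RHS]eq_bigr do rewrite big_distrr /=.
  rewrite exchange_big /=; apply: eq_bigr => k _.
  have -> : (\sum_i v i *+ nu i j) k 0 = \sum_i v i k 0 *+ nu i j.
    by rewrite summxE; apply: eq_bigr => i _; rewrite mulmxnE.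
  rewrite (@abs_sum _ (fun i => v i k 0) (brick w j k 0) (mu j)).
  - by apply: eq_bigr => i _; rewrite mulnC.
  - by move=> i /(muP j).2 [_ []].
  - by move=> i; exact: (nuP i).1.
have n1d : norm1 d = wt h0.
  rewrite norm1_brick; under eq_bigr do rewrite nd.
  rewrite exchange_big /=; apply: eq_bigr => i _.
  by rewrite -big_distrl /= (nuP i).2.
have sd : \sum_i v i *+ h0 i = \sum_j brick d j.
  under [RHS]eq_bigr do rewrite dP; rewrite exchange_big /=.
  by apply: eq_bigr => i _; rewrite sumrMnr (nuP i).2.
have sw : \sum_i v i *+ h i = \sum_j brick w j.
  under [RHS]eq_bigr do rewrite (muP _).1; rewrite exchange_big /=.
  by apply: eq_bigr => i _; rewrite sumrMnr ffunE.
exists d; split.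
- have [i hi] := H0 _ h0H.
  have : (0 < norm1 d)%N.
    by rewrite n1d /wt (bigD1 i) //= addn_gt0 muln_gt0 hi norm1_gt0 ?v0.
  apply: contraTneq => ->; rewrite -leqNgt leqn0 /norm1.
  by rewrite sum_nat_eq0; apply/forallP => k; rewrite mxE.
- split=> k.
    have [j [cc ->]] := flat_surj k.
    have -> : d (flat j cc) 0 = \sum_i v i cc 0 *+ nu i j.
      have /colP/(_ cc) := dP j; rewrite mxE => ->; rewrite summxE.
      by apply: eq_bigr => i _; rewrite mulmxnE.
    have -> : w (flat j cc) 0 = brick w j cc 0 by rewrite mxE.
    apply: (@cle_sum _ _ _ (mu j)) => [i|i|].
    + by move=> /(muP j).2 [_ []].
    + exact: (nuP i).1.
    rewrite {1}(muP j).1 summxE; by apply: eq_bigr => i _; rewrite mulmxnE.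
  case: (split_ordP k) => k' ->.
    rewrite !nfold_mul_top; apply: cle_parts.
    + by have := le0 (inr (k', true)); rewrite /= /val1 sd sw.
    by have := le0 (inr (k', false)); rewrite /= /val1 sd sw.
  have [j [i ->]] := flat_surj k'; rewrite !nfold_mul_brick.
  rewrite dP mulmx_sumr summxE.
  have -> : \sum_i0 (dsubmx A *m (v i0 *+ nu i0 j)) i 0 =
            \sum_i0 (dsubmx A *m v i0) i 0 *+ nu i0 j.
    by apply: eq_bigr => i0 _; rewrite mulmx_natr mulmxnE.
  apply: (@cle_sum _ _ _ (mu j)) => [i0|i0|].
  + by move=> /(muP j).2 [_ []].
  + exact: (nuP i0).1.
  rewrite {1}(muP j).1 mulmx_sumr summxE.
  by apply: eq_bigr => i0 _; rewrite mulmx_natr mulmxnE.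
rewrite n1d; exact: leq_bigmax_seq.
Qed.

(** * Separable convex functions along conformal sums *)

Section Univariate.
Variable g : int -> int.
Hypothesis cg : convexZ g.

(** For p and q of one sign, a + p and a + q are convex combinations of a and
    a + p + q with complementary weights; the two inequalities add up. *)
Lemma convex_superadd2 a p q : (0 <= p /\ 0 <= q) \/ (p <= 0 /\ q <= 0) ->
  g (a + p) + g (a + q) <= g a + g (a + p + q).
Proof.
case=> [[p0 q0]|[p0 q0]].
  have h1 := @cg a (a + p) (a + p + q) (ltac:(lia)) (ltac:(lia)).
  have h2 := @cg a (a + q) (a + p + q) (ltac:(lia)) (ltac:(lia)).
  have [s0|s0] := eqVneq (p + q) 0; last by nia.
  have -> : p = 0 by lia. have -> : q = 0 by lia. by rewrite !addr0.
have h1 := @cg (a + p + q) (a + p) a (ltac:(lia)) (ltac:(lia)).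
have h2 := @cg (a + p + q) (a + q) a (ltac:(lia)) (ltac:(lia)).
have [s0|s0] := eqVneq (p + q) 0; last by nia.
have -> : p = 0 by lia. have -> : q = 0 by lia. by rewrite !addr0.
Qed.

Lemma convex_line a p (m l : nat) : (m <= l)%N ->
  l%:Z * (g (a + p * m%:Z) - g a) <= m%:Z * (g (a + p * l%:Z) - g a).
Proof.
move=> ml; have [p0|p0] := lerP 0 p.
  have h := @cg a (a + p * m%:Z) (a + p * l%:Z) (ltac:(nia)) (ltac:(nia)).
  have [->|p1] := eqVneq p 0; first by rewrite !mul0r !addr0 subrr !mulr0.
  nia.
have h := @cg (a + p * l%:Z) (a + p * m%:Z) a (ltac:(nia)) (ltac:(nia)).
nia.
Qed.

Lemma convex_superadd (I : Type) (r : seq I) (p : I -> int) a :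
  (forall i, 0 <= p i) \/ (forall i, p i <= 0) ->
  \sum_(i <- r) (g (a + p i) - g a) <= g (a + \sum_(i <- r) p i) - g a.
Proof.
move=> sgn; elim: r => [|i r IH]; first by rewrite !big_nil addr0 subrr.
rewrite !big_cons.
have h : g (a + p i) + g (a + \sum_(j <- r) p j) <= g a + g (a + p i + \sum_(j <- r) p j).
  apply: convex_superadd2; case: sgn => h; [left|right]; split=> //.
    by apply: sumr_ge0.
  by apply: sumr_le0.
apply: le_trans (lerD (lexx _) IH) _; rewrite [a + (_ + _)]addrA; move: h; clear.  lra.
Qed.

End Univariate.

Section Separable.
Variables (m N : nat) (M : 'M[int]_(m, N)).

(** Convexity is required with respect to the coordinates of z together with those
    of [M *m z], so that it covers both f and the violation. *)
Definition coordinate (x : 'I_N + 'I_m) (z : 'cV[int]_N) : int :=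
  match x with inl i => z i 0 | inr i => (M *m z) i 0 end.

Lemma coordinateD x y z : coordinate x (y + z) = coordinate x y + coordinate x z.
Proof. by case: x => i /=; rewrite ?mulmxDr mxE. Qed.

Lemma coordinateMn x y k : coordinate x (y *+ k) = coordinate x y * k%:Z.
Proof.
by case: x => i /=; rewrite ?mulmx_natr mulmxnE -mulr_natr natz.
Qed.

Lemma coordinate_sum x (I : finType) (v : I -> 'cV[int]_N) :
  coordinate x (\sum_i v i) = \sum_i coordinate x (v i).
Proof. by case: x => i /=; rewrite ?mulmx_sumr summxE. Qed.

Lemma conformalE u w : conformal M u w -> forall x, cle (coordinate x u) (coordinate x w).
Proof. by case=> h1 h2 [] i /=. Qed.

Definition sep_convex_along (H : 'cV[int]_N -> int) : Prop :=
  exists2 h : 'I_N + 'I_m -> int -> int, (forall x, convexZ (h x)) &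
    forall z, H z = \sum_x h x (coordinate x z).

Variable H : 'cV[int]_N -> int.
Hypothesis cH : sep_convex_along H.

Lemma sep_convex_line z v (k l : nat) : (k <= l)%N ->
  l%:Z * (H (z + v *+ k) - H z) <= k%:Z * (H (z + v *+ l) - H z).
Proof.
case: cH => h ch hE kl; rewrite !hE -!sumrB !mulr_sumr.
by apply: ler_sum => x _; rewrite !coordinateD !coordinateMn; apply: convex_line.
Qed.

Lemma sep_convex_superadd z (I : finType) (v : I -> 'cV[int]_N) w :
  w = \sum_i v i -> (forall i, v i = 0 \/ conformal M (v i) w) ->
  \sum_i (H (z + v i) - H z) <= H (z + w) - H z.
Proof.
case: cH => h ch hE wE cw; rewrite (hE (z + w)) (hE z).
under eq_bigr => i _ do rewrite hE -sumrB.
rewrite exchange_big -sumrB; apply: ler_sum => x _.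
have -> : coordinate x (z + w) = coordinate x z + \sum_i coordinate x (v i).
  by rewrite coordinateD wE coordinate_sum.
under eq_bigr do rewrite coordinateD.
apply: convex_superadd => //.
have [w0|w0] := lerP 0 (coordinate x w); [left|right] => i.
  case: (cw i) => [->|/conformalE/(_ x)]; last by rewrite /cle; lia.
  by case: x {w0} => k /=; rewrite ?mulmx0 mxE.
case: (cw i) => [->|/conformalE/(_ x)]; last by rewrite /cle; lia.
by case: x {w0} => k /=; rewrite ?mulmx0 mxE.
Qed.

End Separable.

Section Directions.
Variable N : nat.

Definition dvec (g q : nat) : 'cV[int]_N := \col_j dir N g q j.

Lemma candE g (z : 'cV[int]_N) k q : cand g z k q = z + dvec g q *+ (2 ^ k)%N.
Proof.
by apply/colP => j; rewrite !mxE entE mulmxnE mxE -mulr_natl natz.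
Qed.

Lemma dvec_cons g (w w' : 'cV[int]_N) c (q : 'I_(ndir N g)) : w' = dvec g q ->
  (c < 2 * N + 1)%N -> (forall j, w j 0 = unit_dir N c j + w' j 0) ->
  exists q' : 'I_(ndir N g.+1), w = dvec g.+1 q'.
Proof.
move=> qE cl wE.
have lt : (q * (2 * N + 1) + c < ndir N g.+1)%N.
  have := ltn_ord q; rewrite /ndir expnSr.
  set B := (2 * N + 1)%N in cl *; set Q := (B ^ g)%N; move: {qE}(nat_of_ord q) => k kQ.
  apply: (@leq_trans (k * B + B)); first by rewrite ltn_add2l.
  by rewrite addnC -mulSn leq_mul2r kQ orbT.
exists (Ordinal lt); apply/colP => j; rewrite mxE wE qE mxE.
have -> : dir N g.+1 (Ordinal lt) j = unit_dir N ((q * (2 * N + 1) + c) %% (2 * N + 1)) j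
  + dir N g ((q * (2 * N + 1) + c) %/ (2 * N + 1)) j by [].
move: cl; set B := (2 * N + 1)%N => cl.
by rewrite modnMDl modn_small // divnMDl ?(leq_ltn_trans _ cl) // divn_small // addn0.
Qed.

(** A nonzero vector loses one unit of 1-norm when a suitable signed unit vector is
    subtracted; the number of that unit vector is the next digit. *)
Lemma dvec_surj g (w : 'cV[int]_N) : (norm1 w <= g)%N ->
  exists q : 'I_(ndir N g), w = dvec g q.
Proof.
elim: g w => [|g IH] w le.
  exists ord0; apply/colP => j; rewrite mxE /=; apply/eqP; rewrite -absz_eq0 -leqn0.
  by apply: leq_trans le; rewrite /norm1 (bigD1 j) //= leq_addr.
have [c [cl [w' [le' wE]]]] : exists c, (c < 2 * N + 1)%N /\ exists w' : 'cV[int]_N,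
    (norm1 w' <= g)%N /\ forall j, w j 0 = unit_dir N c j + w' j 0.
  have [w0|w0] := eqVneq w 0.
    exists (2 * N)%N; split; first by lia.
    exists 0; split; first by rewrite /norm1 big1 // => i _; rewrite mxE.
    move=> j; rewrite w0 !mxE /unit_dir addr0; have := ltn_ord j.
    by case: eqP; case: eqP => //; lia.
  have /existsP[i wi] : [exists i, w i 0 != 0].
    apply: contraNT w0; rewrite negb_exists => /forallP h.
    by apply/eqP/colP => i; have := h i; rewrite negbK mxE => /eqP.
  pose e : int := if 0 < w i 0 then 1 else -1.
  pose w' : 'cV[int]_N := \col_j (w j 0 - (if j == i then e else 0)).
  have n1w' : (norm1 w').+1 = norm1 w.
    rewrite /norm1 [in RHS](bigD1 i) //= (bigD1 i) //= mxE eqxx -addSn.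
    congr (_ + _)%N; last first.
      by apply: eq_bigr => j /negPf ji; rewrite mxE ji subr0.
    by move: wi; rewrite /e; case: ltrP; move: (w i 0) => a; lia.
  exists (if (0 < w i 0)%R then nat_of_ord i else N + i)%N; split.
    by have := ltn_ord i; case: ifP; lia.
  exists w'; split; first by rewrite -ltnS n1w'.
  move=> j; rewrite mxE /unit_dir /e; have := ltn_ord i; have := ltn_ord j.
  have -> : (j == i) = (nat_of_ord i == nat_of_ord j) by rewrite eq_sym.
  move=> lj li; case: (0 < w i 0).
    have -> : (nat_of_ord i == N + j)%N = false by lia.
    by case: ifP => _; ring.
  have -> : (N + i == j)%N = false by lia.
  by rewrite eqn_add2l; case: ifP => _; ring.
have [q qE] := IH w' le'.
exact: dvec_cons qE cl wE.
Qed.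

End Directions.

(** * Geometric convergence of the descent *)

Lemma pigeonhole (I : finType) (a : I -> int) (S : int) : 0 < S -> S <= \sum_i a i ->
  exists i, S <= #|I|%:Z * a i.
Proof.
move=> S0 le; apply: contrapT => /forallNP h.
have lt i : #|I|%:Z * a i < S by rewrite ltNge; apply/negP/h.
have I0 : (0 < #|I|)%N.
  by rewrite lt0n; apply: contraTneq le => /card0_eq e; rewrite big_pred0 ?leNgt ?S0.
have : \sum_i #|I|%:Z * a i < \sum_(i : I) S.
  have /card_gt0P[i0 _] := I0.
  rewrite (bigD1 i0) //= [ltRHS](bigD1 i0) //=; apply: ltr_leD (lt i0) _.
  by apply: ler_sum => i _; exact: ltW.
rewrite -mulr_sumr sumr_const -mulr_natr natz mulrC ltr_pM2r; last by rewrite ltz_nat.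
by rewrite ltNge le.
Qed.

Lemma conformal_multiple (m N : nat) (M : 'M[int]_(m, N)) (I : finType) (v : I -> 'cV[int]_N)
    (mu : I -> nat) w i :
  w = \sum_i v i *+ mu i -> (forall i, (0 < mu i)%N -> conformal M (v i) w) ->
  conformal M (v i *+ mu i) w.
Proof.
move=> wE cv.
have h x : cle (coordinate M x (v i *+ mu i)) (coordinate M x w).
  pose mu0 j := if j == i then mu i else 0%N.
  have le0 j : (mu0 j <= mu j)%N by rewrite /mu0; case: eqP => [->|].
  have := @cle_sum I (fun j => coordinate M x (v j)) (coordinate M x w) mu mu0.
  have -> : \sum_j coordinate M x (v j) *+ mu0 j = coordinate M x (v i *+ mu i).
    rewrite (bigD1 i) //= big1 ?addr0; last first.
      by move=> j /negPf ji; rewrite /mu0 ji mulr0n.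
    by rewrite /mu0 eqxx coordinateMn -mulr_natr natz.
  apply=> //; first by move=> j /cv /conformalE.
  rewrite {1}wE coordinate_sum; apply: eq_bigr => j _.
  by rewrite coordinateMn -mulr_natr natz.
by split=> k; [exact: (h (inl k)) | exact: (h (inr k))].
Qed.

Section Steps.
Variables (m N : nat) (M : 'M[int]_(m, N)) (H : 'cV[int]_N -> int).
Hypothesis cH : sep_convex_along M H.

(** With k the integer part of log_2 l, the step 2^k is more than half of l, and a
    convex function gains at least proportionally at the beginning. *)
Lemma power_of_two_step z d (l L : nat) : (0 < l)%N -> (l < 2 ^ L)%N -> H (z + d *+ l) < H z ->
  exists2 k, (k < L)%N & (2 ^ k <= l)%N /\
    H z - H (z + d *+ l) <= 2 * (H z - H (z + d *+ (2 ^ k)%N)).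
Proof.
move=> l0 lL lt; have := trunc_log_bounds (isT : (1 < 2)%N) l0.
set k := trunc_log 2 l => /andP[k1 k2]; exists k.
  by rewrite -(@ltn_exp2l 2) //; apply: leq_ltn_trans k1 lL.
split=> //; have := sep_convex_line cH z d k1; rewrite expnS in k2.
move: (H z) (H (z + d *+ l)) (H (z + d *+ (2 ^ k)%N)) lt => a b c lt h.
by nia.
Qed.

(** Let l' be the least multiple of d reaching the value at l.  By convexity H
    decreases strictly on all of [0, l'], each time by at least one, so
    l' <= H z for H with nonnegative integer values.  Thus the
    initial value of H caps the step lengths, however far away its minimizers
    are. *)
Lemma short_step z d (l : nat) : (forall x, 0 <= H x) -> H (z + d *+ l) < H z ->
  exists l', [/\ (0 < l')%N, l'%:Z <= H z & H (z + d *+ l') <= H (z + d *+ l)].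
Proof.
move=> H0 lt.
have ex : exists l', H (z + d *+ l') <= H (z + d *+ l) by exists l.
case: (ex_minnP ex) => l' le' min; exists l'.
have l'0 : (0 < l')%N.
  by rewrite lt0n; apply: contraTneq le' => ->; rewrite mulr0n addr0 -ltNge.
split=> //; have lt1 : H (z + d *+ l) < H (z + d *+ l'.-1).
  rewrite ltNge; apply/negP => /min; lia.
have := sep_convex_line cH z d (leq_pred l'); have := H0 (z + d *+ l').
move: (H z) (H (z + d *+ l)) (H (z + d *+ l')) (H (z + d *+ l'.-1)) le' lt lt1.
move=> a b c e h1 h2 h3 h4; case: l' l'0 {min} => // k _ /=; nia.
Qed.

End Steps.

Section Progress.
Variables (m N : nat) (M : 'M[int]_(m, N)) (g : nat).
Hypothesis Hg : forall w : 'cV[int]_N, w != 0 ->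
  exists d, [/\ d != 0, conformal M d w & (norm1 d <= g)%N].
Let Q := ndir N g.

Lemma dvec_decomp (w : 'cV[int]_N) : exists mu : 'I_Q -> nat,
  w = \sum_(q < Q) dvec N g q *+ mu q /\
  forall q : 'I_Q, (0 < mu q)%N -> dvec N g q != 0 /\ conformal M (dvec N g q) w.
Proof.
apply: conformal_decomp => x /Hg[d [d0 cd /dvec_surj[q dE]]].
by exists q; rewrite -dE.
Qed.

Variable H : 'cV[int]_N -> int.
Hypothesis cH : sep_convex_along M H.

(** The total gain of the terms of a conformal decomposition of zs - z is at least
    H z - H zs by superadditivity; one of Q terms attains the average. *)
Lemma best_direction z zs : H zs < H z -> exists (q : 'I_Q) (l : nat),
  [/\ (0 < l)%N, dvec N g q != 0, conformal M (dvec N g q *+ l) (zs - z) &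
      H z - H zs <= Q%:Z * (H z - H (z + dvec N g q *+ l))].
Proof.
move=> lt; have [mu [wE hmu]] := dvec_decomp (zs - z).
have cm (q : 'I_Q) : conformal M (dvec N g q *+ mu q) (zs - z).
  by apply: (conformal_multiple q wE) => q' /hmu[].
have le : H z - H zs <= \sum_(q < Q) (H z - H (z + dvec N g q *+ mu q)).
  have := sep_convex_superadd cH z wE (fun q => or_intror (cm q)).
  rewrite (addrC z (zs - z)) subrK => h; rewrite -lerN2 -sumrN opprB.
  by under eq_bigr do rewrite opprB.
have S0 : 0 < H z - H zs by rewrite subr_gt0.
have [q hq] := pigeonhole S0 le; rewrite card_ord in hq.
have mu0 : (0 < mu q)%N.
  rewrite lt0n; apply: contraTneq hq => ->.
  by rewrite mulr0n addr0 subrr mulr0 -ltNge.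
by exists q, (mu q); split=> //; have [] := hmu q mu0.
Qed.

End Progress.

(** Bernoulli's inequality gives (1 - 1/K)^K <= 1/2; the denominators are
    cleared. *)
Lemma half_power (K B : nat) : (0 < K)%N -> (2 ^ B * (K.-1) ^ (K * B) <= K ^ (K * B))%N.
Proof.
case: K => // k _ /=.
have bern a n : (a ^ n + n * a ^ n.-1 <= a.+1 ^ n)%N.
  elim: n => // n IH; rewrite /= [in leqRHS]expnS; case: n IH => [|n] IH /=; first by lia.
  rewrite /= in IH; rewrite !expnS in IH *; nia.
have h : (2 * k ^ k.+1 <= k.+1 ^ k.+1)%N.
  have := bern k k.+1; rewrite /= expnS; nia.
by rewrite !expnM -expnMn leq_exp2l_base.
Qed.

Lemma geometric_step (K k x y p p' p0 : nat) :
  (x * p <= y * p0 -> K * p' <= k * p -> K * x * p' <= k * y * p0)%N.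
Proof.
move=> h1 h2; have := leq_mul (leqnn x) h2; have := leq_mul (leqnn k) h1; lia.
Qed.

Lemma gap_closed (a x y p0 p : nat) :
  (p0 < a -> 0 < x -> a * x <= y -> y * p <= x * p0 -> p = 0)%N.
Proof.
move=> lt0 x0 h1 h2; case: (posnP p) => // p_gt0.
have : (a * x * p <= x * p0)%N by apply: leq_trans h2; rewrite leq_mul2r h1 orbT.
nia.
Qed.

Section Descent.
Variables (N g L : nat) (better : 'cV[int]_N -> 'cV[int]_N -> bool).
Variables (valid : pred 'cV[int]_N) (H : 'cV[int]_N -> int).
Hypothesis betterE : forall z c, valid z -> better z c = valid c && (H c < H z).
Let Q := ndir N g.
Let st := scan g L better.

Lemma scanP z : valid z -> [/\ valid (st z), H (st z) <= H z &
  forall k q, (k < L)%N -> (q < Q)%N -> valid (cand g z k q) -> H (st z) <= H (cand g z k q)].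
Proof.
move=> vz.
pose f p b := keep_better g L better z b p.
have pre P : valid (iteri P f z) /\ H (iteri P f z) <= H z /\
   forall p, (p < P)%N -> let c := cand g z (minn (p %/ Q) L) (p %% Q) in
     valid c -> H (iteri P f z) <= H c.
  elim: P => [//|P [v1 [h1 IH]]] /=.
  set b := iteri P f z in v1 h1 IH *; change (f P b) with (keep_better g L better z b P);
    rewrite /keep_better -/Q.
  set c := cand _ _ _ _; rewrite betterE //.
  have hb : valid (if valid c && (H c < H b) then c else b) /\
     H (if valid c && (H c < H b) then c else b) <= H b /\
     (valid c -> H (if valid c && (H c < H b) then c else b) <= H c).
    case: ifP => [/andP[vc lt]|/negbT]; first by split=> //; split=> //; exact: ltW.
    by rewrite negb_and -leNgt => /orP h; split=> //; split=> // vc; case: h => //; rewrite vc.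
  set b' := (if _ then _ else _) in hb *; case: hb => v' [h' hc].
  split=> //; split; first exact: le_trans h' h1.
  move=> p; rewrite ltnS leq_eqVlt => /orP[/eqP -> //|lt vp].
  exact: le_trans h' (IH p lt vp).
have [v [h1 h2]] := pre (Q * L)%N; split=> // k q kL qQ.
have := h2 (k * Q + q)%N; rewrite divnMDl 1?(leq_ltn_trans _ qQ) // divn_small //.
rewrite addn0 modnMDl modn_small // (minn_idPl (ltnW kL)); apply.
apply: (@leq_trans (k.+1 * Q)); first by rewrite mulSn addnC ltn_add2r.
by rewrite mulnC leq_mul2l kL orbT.
Qed.

Variables (zs : 'cV[int]_N).
Hypothesis zsmin : forall z, valid z -> H zs <= H z.
Hypothesis progress : forall z, valid z -> H zs < H z -> exists k q,
  [/\ (k < L)%N, (q < Q)%N, valid (cand g z k q) &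
      H z - H zs <= (2 * Q)%N%:Z * (H z - H (cand g z k q))].

(** The gap [phi j] after [j] rounds satisfies 2Q phi (j+1) <= (2Q - 1) phi j, hence
    it is below 2^B (1/2)^B after 2Q B rounds, that is 0.  A round that does not
    improve must start at a minimizer, by [progress]. *)
Lemma descent z0 B : valid z0 -> H z0 - H zs < (2 ^ B)%N%:Z ->
  exists M : nat, [/\ (M <= 2 * Q * B)%N,
    forall j, (j < M)%N -> better (iter j st z0) (st (iter j st z0)),
    ~~ better (iter M st z0) (st (iter M st z0)),
    valid (iter M st z0) & H (iter M st z0) = H zs].
Proof.
move=> v0 gap0.
have vj j : valid (iter j st z0) by elim: j => //= j /scanP[].
pose phi j := `|H (iter j st z0) - H zs|%N.
have phiE j : (phi j)%:Z = H (iter j st z0) - H zs.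
  by rewrite /phi gez0_abs // subr_ge0 zsmin.
have dec j : ((2 * Q) * phi j.+1 <= (2 * Q).-1 * phi j)%N.
  have [v1 h1 h2] := scanP (vj j).
  have [lt|] := ltrP (H zs) (H (iter j st z0)); last first.
    move=> le; suff -> : phi j.+1 = 0%N by rewrite muln0.
    apply/eqP; rewrite absz_eq0 subr_eq0 eq_le zsmin ?andbT //.
    exact: le_trans h1 le.
  have [k [q [kL qQ vc hc]]] := progress (vj j) lt.
  have := h2 k q kL qQ vc; rewrite -[st _]/(iter j.+1 st z0).
  have := phiE j; have := phiE j.+1; move: hc.
  move: (H (iter j st z0)) (H (iter j.+1 st z0)) (H (cand _ _ _ _)) (H zs) => a b c d.
  have : (0 < 2 * Q)%N by rewrite muln_gt0 /= (leq_ltn_trans _ qQ).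
  case: (2 * Q)%N => // K _ /=; move: (phi j) (phi j.+1) => x y; nia.
have pw j : ((2 * Q) ^ j * phi j <= (2 * Q).-1 ^ j * phi 0)%N.
  elim: j => // j IH; rewrite !expnS.
  exact: geometric_step IH (dec j).
have Q0 : (0 < 2 * Q)%N by rewrite muln_gt0 /= expn_gt0 addn1.
have phi0 : phi (2 * Q * B)%N = 0%N.
  have := pw (2 * Q * B)%N; have := half_power B Q0.
  have lt0 : (phi 0 < 2 ^ B)%N by rewrite -ltz_nat phiE.
  have K1 : (0 < (2 * Q).-1)%N by have : (0 < Q)%N; [rewrite expn_gt0 addn1 | lia].
  have xp : (0 < (2 * Q).-1 ^ (2 * Q * B))%N by rewrite expn_gt0 K1.
  by move=> h1 h2; exact: gap_closed lt0 xp h1 h2.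
have stopped j : phi j = 0%N -> ~~ better (iter j st z0) (st (iter j st z0)).
  move=> p0; rewrite betterE // negb_and -leNgt; apply/orP; right.
  have [v1 _ _] := scanP (vj j); have := phiE j; rewrite p0 => e.
  apply: le_trans (zsmin v1); lia.
have ex : exists M, ~~ better (iter M st z0) (st (iter M st z0)).
  by exists (2 * Q * B)%N; exact: stopped.
case: (ex_minnP ex) => M stop min; exists M; split=> //.
- by apply: min; apply: stopped.
- by move=> j lt; apply: contraTT lt => /min; rewrite -leqNgt.
apply/eqP; rewrite eq_le zsmin // andbT leNgt; apply/negP => lt.
have [k [q [kL qQ vc hc]]] := progress (vj M) lt.
have [v1 h1 h2] := scanP (vj M); have := h2 k q kL qQ vc.
move: stop; rewrite betterE // v1 /= -leNgt => h3 h4.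
have : H (iter M st z0) - H (cand g (iter M st z0) k q) <= 0.
  by rewrite subr_le0; exact: le_trans h3 h4.
move: hc lt; move: (H (iter M st z0)) (H (cand _ _ _ _)) (H zs) => a b c; nia.
Qed.

End Descent.

(** * Feasibility, recession directions and the feasible box *)

Lemma convex_abs (c : int) : convexZ (fun y => `|c - y|).
Proof.
move=> x y z xy yz; have e : (z - x) * (c - y) = (z - y) * (c - x) + (y - x) * (c - z) by ring.
have h : `|(z - x) * (c - y)| <= `|(z - y) * (c - x)| + `|(y - x) * (c - z)|.
  by rewrite e ler_normD.
have zx : 0 <= z - x by rewrite subr_ge0 (le_trans xy).
have zy : 0 <= z - y by rewrite subr_ge0.
have yx : 0 <= y - x by rewrite subr_ge0.
by move: h; rewrite !normrM (ger0_norm zx) (ger0_norm zy) (ger0_norm yx).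
Qed.

Lemma convex_lo_gap v : convexZ (lo_gap v).
Proof.
move=> x y z xy yz; rewrite /lo_gap; case: (is_node v); last by case: ifP; lia.
move: (to_int _) => a.
by case: (lerP y a); case: (lerP x a); case: (lerP z a) => *; nia.
Qed.

Lemma convex_up_gap v : convexZ (up_gap v).
Proof.
move=> x y z xy yz; rewrite /up_gap; case: (is_node v); last by case: ifP; lia.
move: (to_int _) => a.
by case: (lerP a y); case: (lerP a x); case: (lerP a z) => *; nia.
Qed.

Lemma convexD g h : convexZ g -> convexZ h -> convexZ (fun y => g y + h y).
Proof.
move=> cg ch x y z xy yz; have := cg x y z xy yz; have := ch x y z xy yz.
rewrite !mulrDr; lra.
Qed.

Lemma lo_gap_ge0 v z : 0 <= lo_gap v z.
Proof. by rewrite /lo_gap; case: ifP => _; case: ifP => //; rewrite subr_ge0. Qed.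

Lemma up_gap_ge0 v z : 0 <= up_gap v z.
Proof. by rewrite /up_gap; case: ifP => _; case: ifP => //; rewrite subr_ge0. Qed.

Lemma lo_gap_eq0 (e : \bar int) z : (lo_gap (enc_ext e) z == 0) = (e <= z%:E)%E.
Proof.
case: e => [a||]; rewrite /lo_gap /= ?lee_fin ?leye_eq ?leNye //.
by case: ifP; rewrite ?subr_eq0; lia.
Qed.

Lemma up_gap_eq0 (e : \bar int) z : (up_gap (enc_ext e) z == 0) = (z%:E <= e)%E.
Proof.
case: e => [a||]; rewrite /up_gap /= ?lee_fin ?leeNy_eq ?leey //.
by case: ifP; rewrite ?subr_eq0; lia.
Qed.

Section Viol.
Variables (r s t : nat) (A : 'M[int]_(r + s, t)) (n : nat).
Variables (l u : 'cV[\bar int]_(n * t)) (b : 'cV[int]_(r + n * s)).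
Implicit Types z : 'cV[int]_(n * t).
Let M := nfold A n.

(** The connection between the arithmetic on indices carried out by the program and
    the n-fold matrix. *)
Lemma violE z : viol A l u b z =
  \sum_i `|b i 0 - (M *m z) i 0| +
  \sum_k (lo_gap (enc_ext (l k 0)) (z k 0) + up_gap (enc_ext (u k 0)) (z k 0)).
Proof.
rewrite /viol; congr (_ + _); last first.
  by rewrite big_mkord; apply: eq_bigr => k _; rewrite /bound_gap !eentE entE.
rewrite big_split_ord /=; congr (_ + _); rewrite !big_mkord.
  apply: eq_bigr => i _; congr (`| _ - _ |); first exact: (entE b (lshift (n * s) i)).
  rewrite mxE sum_flat big_mkord; apply: eq_bigr => j _.
  rewrite big_mkord; apply: eq_bigr => c _.
  rewrite nfold_top; congr (_ * _); first exact: (mat_entryE A (lshift s i) c).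
  exact: (entE z (flat j c)).
rewrite sum_flat; apply: eq_bigr => j _; rewrite big_mkord; apply: eq_bigr => i _.
congr (`| _ - _ |); first exact: (entE b (rshift r (flat j i))).
rewrite nfold_mul_brick mxE big_mkord; apply: eq_bigr => c _.
rewrite !mxE; congr (_ * _); first exact: (mat_entryE A (rshift r i) c).
exact: (entE z (flat j c)).
Qed.

Lemma viol_ge0 z : 0 <= viol A l u b z.
Proof.
rewrite violE addr_ge0 //; apply: sumr_ge0 => i _ //.
by rewrite addr_ge0 ?lo_gap_ge0 ?up_gap_ge0.
Qed.

Lemma viol_sep_convex : sep_convex_along M (viol A l u b).
Proof.
pose h (x : 'I_(n * t) + 'I_(r + n * s)) : int -> int := match x with
  | inl k => fun y => lo_gap (enc_ext (l k 0)) y + up_gap (enc_ext (u k 0)) y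
  | inr i => fun y => `|b i 0 - y| end.
exists h => [[k|i]|z].
- by apply: convexD; [exact: convex_lo_gap | exact: convex_up_gap].
- exact: convex_abs.
by rewrite violE addrC big_sumType.
Qed.

Lemma viol_eq0 z : viol A l u b z = 0 <-> feasible A l u b z.
Proof.
rewrite violE; split.
  move=> /eqP; rewrite paddr_eq0; last 2 first.
  - exact: sumr_ge0.
  - by apply: sumr_ge0 => k _; rewrite addr_ge0 ?lo_gap_ge0 ?up_gap_ge0.
  move=> /andP[/eqP h1 /eqP h2]; split.
    apply/colP => i; have /psumr_eq0P h := h1.
    have /eqP := h (fun i _ => normr_ge0 _) i isT.
    by rewrite normr_eq0 subr_eq0 => /eqP ->.
  move=> k; have /psumr_eq0P h := h2.
  have h0 i : 0 <= lo_gap (enc_ext (l i 0)) (z i 0) + up_gap (enc_ext (u i 0)) (z i 0).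
    by rewrite addr_ge0 ?lo_gap_ge0 ?up_gap_ge0.
  have /eqP := h (fun i _ => h0 i) k isT.
  by rewrite paddr_eq0 ?lo_gap_ge0 ?up_gap_ge0 // lo_gap_eq0 up_gap_eq0.
case=> e h; rewrite big1 ?add0r => [|i _]; last by rewrite /M e subrr normr0.
rewrite big1 // => k _; have := h k; rewrite -lo_gap_eq0 -up_gap_eq0.
by move=> /andP[/eqP -> /eqP ->].
Qed.

End Viol.

Section Recession.
Variables (r s t : nat) (A : 'M[int]_(r + s, t)) (n : nat).
Variables (l u : 'cV[\bar int]_(n * t)) (b : 'cV[int]_(r + n * s)).
Implicit Types z d : 'cV[int]_(n * t).
Let M := nfold A n.
Let S := feasible A l u b.

(** The recession cone of the feasible set is the feasible set of the homogeneous
    program: finite bounds become 0, and unbounded sides stay unbounded.  Hence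
    recession is tested by the same violation function. *)
Definition rec_lo : 'cV[\bar int]_(n * t) :=
  \col_k (if is_node (eent l k) then 0%E else if (to_int (eent l k) <= 0) then -oo%E else 0%E).
Definition rec_up : 'cV[\bar int]_(n * t) :=
  \col_k (if is_node (eent u k) then 0%E else if (0 <= to_int (eent u k)) then +oo%E else 0%E).

Definition recession d : Prop := feasible A rec_lo rec_up 0 d.

Lemma recession_infinite z d : S z -> d != 0 -> recession d -> ~ finite_set S.
Proof.
move=> [Mz bz] d0 [Md bd] fin.
have inS k : S (z + d *+ k).
  split; first by rewrite mulmxDr mulmx_natr Mz Md mul0rn addr0.
  move=> i; have := bd i; have := bz i; rewrite !mxE !eentE mulmxnE.
  move=> /andP[h1 h2] /andP[h3 h4]; apply/andP; split.
    case: (l i 0) h1 h3 => [a||] /=; rewrite ?lee_fin ?leye_eq ?leNye // => h1 h3.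
    by rewrite ler_wpDr // mulrn_wge0.
  case: (u i 0) h2 h4 => [a||] /=; rewrite ?lee_fin ?leeNy_eq ?leey // => h2 h4.
  by rewrite -[leRHS]addr0 lerD // mulrn_wle0.
apply: infinite_nat; have -> : ([set: nat] = (fun k => z + d *+ k) @^-1` S)%classic.
  by apply/seteqP; split=> k //= _; exact: inS.
apply: finite_preimage => // k k' _ _ /addrI e.
have /existsP[i di] : [exists i, d i 0 != 0].
  apply: contraNT d0; rewrite negb_exists => /forallP h.
  by apply/eqP/colP => i; have := h i; rewrite negbK mxE => /eqP.
have := congr1 (fun x : 'cV[int]_(n * t) => x i 0) e; rewrite /= !mulmxnE.
rewrite -[LHS]mulr_natr -[RHS]mulr_natr => /(mulfI di) /eqP.
by rewrite !natz eqz_nat => /eqP.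
Qed.

(** A bound on the distance from [z] to each of its finite bounds; the
    second component of the encoding of an infinite bound reads as 0. *)
Definition box_size z : nat :=
  `|(\sum_(0 <= k < n * t) (`|to_int (apply1 Snd (eent l k))| +
       `|to_int (apply1 Snd (eent u k))| + `|ent z k|))%R|%N.

Lemma box_size_ge z (k : 'I_(n * t)) : `|to_int (apply1 Snd (enc_ext (l k 0)))| +
  `|to_int (apply1 Snd (enc_ext (u k 0)))| + `|z k 0| <= (box_size z)%:Z.
Proof.
rewrite /box_size big_mkord gez0_abs; last first.
  by apply: sumr_ge0 => i _; rewrite !addr_ge0.
rewrite (bigD1 k) //= !eentE entE lerDl; apply: sumr_ge0 => i _.
by rewrite !addr_ge0.
Qed.

Variable g : nat.
Hypothesis Hg : forall w : 'cV[int]_(n * t), w != 0 ->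
  exists d, [/\ d != 0, conformal M d w & (norm1 d <= g)%N].
Let Q := ndir (n * t) g.
Hypothesis norec : forall q : 'I_Q, dvec (n * t) g q != 0 -> ~ recession (dvec (n * t) g q).

(** The direction lies in the kernel, because it is conformal to a kernel vector.
    Not being a recession direction, it moves some coordinate towards a finite
    bound, and the multiple [m] cannot overshoot that bound. *)
Lemma step_bounded z z1 (q : 'I_Q) m : S z -> S z1 -> dvec (n * t) g q != 0 ->
  conformal M (dvec (n * t) g q *+ m) (z - z1) -> (m <= box_size z1)%N.
Proof.
move=> [Mz bz] [Mz1 bz1] d0 cm; have [->//|m0] := posnP m.
have Md : M *m dvec (n * t) g q = 0.
  apply/colP => i; have := cm.2 i; rewrite mulmxBr Mz Mz1 subrr mulmx_natr mulmxnE.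
  move: ((M *m _) i 0) => a; rewrite !mxE -mulr_natr natz /cle; nia.
have /existsNP[k] : ~ forall k, (rec_lo k 0%R <= (dvec (n * t) g q k 0%R)%:E <= rec_up k 0%R)%E.
  by move=> h; apply: (norec d0).
have := box_size_ge z1 k; have := cm.1 k; have := bz k; have := bz1 k.
rewrite !mxE mulmxnE mxE !eentE -mulr_natr natz.
move: (dir _ _ _ _) (z k 0) (z1 k 0) (box_size z1) => d x y W.
case: (l k 0) => [a||]; case: (u k 0) => [c||] //=;
  rewrite ?lee_fin ?leye_eq ?leNye ?leeNy_eq ?leey //= ?andbT /cle;
  try (by move=> /andP[_ /eqP]); by clear -m0; nia.
Qed.

(** The conformal decomposition of z - z1 has Q terms, with multiplicities bounded
    by [step_bounded] and entries bounded by [g]. *)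
Lemma box_bounded z z1 : S z -> S z1 -> forall k,
  (`|z k 0%R - z1 k 0%R| <= Q * (box_size z1 * g))%N.
Proof.
move=> Sz Sz1 k; have [mu [wE hmu]] := dvec_decomp Hg (z - z1).
have -> : z k 0 - z1 k 0 = \sum_(q < Q) dvec (n * t) g q k 0 *+ mu q.
  have := congr1 (fun x : 'cV[int]_(n * t) => x k 0) wE; rewrite /= !mxE => ->.
  by rewrite summxE; apply: eq_bigr => q _; rewrite mulmxnE.
apply: (@leq_trans (\sum_(q < Q) box_size z1 * g)); last first.
  by rewrite sum_nat_const card_ord.
have tri : (`|(\sum_(q < Q) dvec (n * t) g q k 0 *+ mu q)%R| <=
            \sum_(q < Q) `|(dvec (n * t) g q k 0 *+ mu q)%R|)%N.
  elim/big_ind2: _ => // x1 x2 y1 y2 h1 h2; lia.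
apply: leq_trans tri _; apply: leq_sum => q _.
case: (posnP (mu q)) => [->|m0]; first by rewrite mulr0n.
have [d0 _] := hmu q m0.
have cm := conformal_multiple q wE (fun q h => (hmu q h).2).
have := step_bounded Sz Sz1 d0 cm; have := abs_dir (n * t) g q k.
rewrite mxE -mulr_natr natz abszM absz_nat => h1 h2; rewrite [leqRHS]mulnC; exact: leq_mul.
Qed.

End Recession.

(** * Correctness of the two descents *)

Lemma exists_minimum (T : Type) (P : T -> Prop) (phi : T -> nat) : (exists z, P z) ->
  exists zs, P zs /\ forall z, P z -> (phi zs <= phi z)%N.
Proof.
move=> [z0 Pz0].
have ex : exists k, `[< exists z, P z /\ phi z = k >] by exists (phi z0); apply/asboolP; exists z0.
case: (ex_minnP ex) => k /asboolP[zs [Pzs <-]] min; exists zs; split=> // z Pz.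
by apply: min; apply/asboolP; exists z.
Qed.

Lemma finite_box (N : nat) (c : 'cV[int]_N) (R : nat) (S : set 'cV[int]_N) :
  (forall z, S z -> forall k, (`|z k 0%R - c k 0%R| <= R)%N) -> finite_set S.
Proof.
move=> h; pose F (x : {ffun 'I_N -> 'I_(2 * R).+1}) : 'cV[int]_N :=
  \col_k (c k 0 + (x k)%:Z - R%:Z).
apply: (@sub_finite_set _ _ (F @` [set: {ffun 'I_N -> 'I_(2 * R).+1}])%classic); last first.
  by apply: finite_image; exact: finite_finset.
move=> z Sz; have hz := h z Sz.
exists [ffun k => inord `|(z k 0 - c k 0 + R%:Z)%R|%N] => //.
apply/colP => k; rewrite mxE ffunE inordK; last first.
  have := hz k; move: (z k 0) (c k 0) => x y; lia.
have := hz k; move: (z k 0) (c k 0) => x y; lia.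
Qed.

Lemma fhat_ge (N : nat) (S : set 'cV[int]_N) f z : finite_set S -> S z ->
  (`|f z| <= fhat S f)%N.
Proof.
move=> fin Sz; apply: (@leq_bigmax_seq _ _ xpredT (fun x => `|f x|%N)) => //.
by rewrite in_fset_set // inE.
Qed.

Section Phases.
Variables (r s t : nat) (A : 'M[int]_(r + s, t)) (n : nat).
Variables (l u : 'cV[\bar int]_(n * t)) (b : 'cV[int]_(r + n * s)).
Let N := (n * t)%N.
Let M := nfold A n.
Let S := feasible A l u b.
Let v := viol A l u b.
Variable g : nat.
Hypothesis Hg : forall w : 'cV[int]_(n * t), w != 0 ->
  exists d, [/\ d != 0, conformal M d w & (norm1 d <= g)%N].
Let Q := ndir N g.

Definition less_violated (z c : 'cV[int]_(n * t)) : bool := viol A l u b c < viol A l u b z.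
(** Exponents up to the bit length of the initial violation suffice, by
    [short_step]. *)
Definition repair_length : nat := bitlen (viol A l u b 0).
Definition repair_step := scan g repair_length less_violated.

Lemma repair_descent : exists m : nat, [/\ (m <= 2 * Q * repair_length)%N,
  forall j, (j < m)%N -> less_violated (iter j repair_step 0) (repair_step (iter j repair_step 0)),
  ~~ less_violated (iter m repair_step 0) (repair_step (iter m repair_step 0)) &
  forall z, v (iter m repair_step 0) <= v z].
Proof.
have v0 := viol_ge0 A l u b.
have [zs [_ zsm]] := exists_minimum (fun z => `|v z|%N)
  (ex_intro (fun=> True) (0 : 'cV[int]_(n * t)) I).
have zsmin z : v zs <= v z.
  by have := zsm z I; have := v0 z; have := v0 zs; rewrite -/(v z) -/(v zs); lia.
(* The violation never grows; this keeps the step lengths sufficient. *)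
pose valid z := v z <= v 0.
have bE z c : valid z -> less_violated z c = valid c && (v c < v z).
  rewrite /valid /less_violated -/(v z) -/(v c) => vz.
  by case: ltP => // lt; rewrite ?andbF // (ltW (lt_le_trans lt vz)).
have prog z : valid z -> v zs < v z -> exists k q,
    [/\ (k < repair_length)%N, (q < Q)%N, valid (cand g z k q) &
      v z - v zs <= (2 * Q)%N%:Z * (v z - v (cand g z k q))].
  move=> vz lt; have cv := viol_sep_convex A l u b.
  have [q [m [m0 d0 cm hq]]] := best_direction Hg cv lt.
  have lt1 : v (z + dvec N g q *+ m) < v z.
    rewrite -subr_gt0; move: hq; rewrite -/v.
    move: (v z - v (z + _)) => a; have : 0 < v z - v zs by rewrite subr_gt0.
    by move: (v z - v zs) => e; clear; nia.
  have [m' [m'0 le' h']] := short_step cv v0 lt1.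
  have m'L : (m' < 2 ^ repair_length)%N.
    apply: (@leq_trans (2 ^ repair_length.-1)); last by rewrite leq_exp2l // leq_pred.
    apply: leq_ltn_trans (ltn_bitlen (v 0)); have := v0 0; rewrite -/(v 0).
    move: vz; rewrite /valid; move: le'; rewrite -/v; lia.
  have [k kL [_ hk]] := power_of_two_step cv m'0 m'L (le_lt_trans h' lt1).
  have fin : v z - v zs <= (2 * Q)%N%:Z * (v z - v (cand g z k q)).
    apply: le_trans hq _; rewrite candE PoszM [2%:Z * _]mulrC -mulrA.
    apply: ler_wpM2l => //; apply: le_trans _ hk; rewrite lerD2l lerN2; exact: h'.
  exists k, (nat_of_ord q); split=> //.
  rewrite /valid; apply: le_trans vz; rewrite -subr_ge0.
  have Q0 : 0 < (2 * Q)%N%:Z by rewrite ltz_nat muln_gt0 /= expn_gt0 addn1.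
  rewrite -(pmulr_rge0 _ Q0); apply: le_trans fin; rewrite subr_ge0; exact: ltW.
have gap0 : v 0 - v zs < (2 ^ repair_length)%N%:Z.
  have h1 := ltn_bitlen (v 0).
  have h2 : (2 ^ repair_length.-1 <= 2 ^ repair_length)%N by rewrite leq_exp2l // leq_pred.
  have := v0 0; have := v0 zs; move: h1 h2; rewrite -/(v 0) -/(v zs) /repair_length -/(v 0).
  by move: (2 ^ _)%N (2 ^ _)%N => x y; lia.
have vv : valid 0 by rewrite /valid.
have [m [h1 h2 h3 _ h5]] := descent bE (fun z _ => zsmin z) prog vv gap0.
by exists m; split=> // z; rewrite -/repair_step h5.
Qed.

Variable f : 'cV[int]_(n * t) -> int.
Hypothesis cf : separable_convex f.
Variable z1 : 'cV[int]_(n * t).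
Hypothesis Sz1 : S z1.
Hypothesis norec : forall q : 'I_Q, dvec N g q != 0 -> ~ recession A l u (dvec N g q).

Lemma feasible_finite : finite_set S.
Proof.
apply: (@finite_box _ z1 (Q * (box_size l u z1 * g))) => z Sz k.
exact: (box_bounded Hg norec Sz Sz1).
Qed.

Lemma separable_sep_convex : sep_convex_along M f.
Proof.
case: cf => h ch fE.
pose h' (x : 'I_(n * t) + 'I_(r + n * s)) : int -> int :=
  match x with inl k => h k | inr _ => fun=> 0 end.
exists h' => [[k|i]|z]; first exact: ch.
  by move=> x y z; rewrite !mulr0 addr0.
by rewrite fE big_sumType /= [X in _ + X]big1 // addr0.
Qed.

Definition cheaper (z c : 'cV[int]_(n * t)) : bool :=
  (viol A l u b c == 0) && ~~ (f z <= f c).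
(** Multiplicities in the decomposition of a difference of two feasible points are
    at most twice the bound of [box_bounded]. *)
Definition improve_length : nat := bitlen (2 * (Q * (box_size l u z1 * g)))%N.
Definition improve_step := scan g improve_length cheaper.

(** The candidate lies coordinatewise between [z] and [zs], and the direction is in
    the kernel. *)
Lemma cand_feasible z zs d (k m : nat) : S z -> S zs -> (0 < m)%N -> (k <= m)%N ->
  conformal M (d *+ m) (zs - z) -> S (z + d *+ k).
Proof.
move=> [Mz bz] [Mzs bzs] m0 km [c1 c2].
split.
  suff Md : M *m d = 0 by rewrite mulmxDr mulmx_natr Mz Md mul0rn addr0.
  apply/colP => i; have := c2 i; rewrite mulmxBr Mz Mzs subrr mulmx_natr mulmxnE.
  move: ((M *m _) i 0) => a; rewrite !mxE -mulr_natr natz /cle; nia.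
move=> i; have := c1 i; have := bz i; have := bzs i; rewrite !mxE !mulmxnE.
rewrite -[d i 0 *+ k]mulr_natr -[d i 0 *+ m]mulr_natr !natz;
  move: (d i 0) (z i 0) (zs i 0) => a x y.
move=> /andP[h1 h2] /andP[h3 h4] h5; apply/andP; split.
  have [le|lt] := lerP x (x + a * k%:Z); first by apply: le_trans h3 _; rewrite lee_fin.
  apply: le_trans h1 _; rewrite lee_fin; move: h5 lt km m0; rewrite /cle; clear; nia.
have [le|lt] := lerP (x + a * k%:Z) x; first by apply: le_trans h4; rewrite lee_fin.
apply: le_trans h2; rewrite lee_fin; move: h5 lt km m0; rewrite /cle; clear; nia.
Qed.

Lemma improve_descent : exists m : nat, [/\ (m <= 2 * Q * (bitlen (fhat S f)).+1)%N,
  forall j, (j < m)%N -> cheaper (iter j improve_step z1) (improve_step (iter j improve_step z1)),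
  ~~ cheaper (iter m improve_step z1) (improve_step (iter m improve_step z1)) &
  minimizer S f (iter m improve_step z1)].
Proof.
have fin := feasible_finite.
have fh z : S z -> `|f z| <= (fhat S f)%:Z.
  by move=> Sz; have := fhat_ge f fin Sz; lia.
have [zs [Szs zsm]] := exists_minimum (fun z => `|(f z + (fhat S f)%:Z)%R|%N)
  (ex_intro S z1 Sz1).
have zsmin z : S z -> f zs <= f z.
  by move=> Sz; have := zsm z Sz; have := fh z Sz; have := fh zs Szs; lia.
pose valid z := v z == 0.
have validP z : valid z <-> S z.
  split=> [/eqP h|h]; first by apply/(viol_eq0 A l u b z).
  by apply/eqP/(viol_eq0 A l u b z).
have bE z c : valid z -> cheaper z c = valid c && (f c < f z).
  by move=> _; rewrite /cheaper -ltNge.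
have cfs := separable_sep_convex.
have prog z : valid z -> f zs < f z -> exists k q,
    [/\ (k < improve_length)%N, (q < Q)%N, valid (cand g z k q) &
      f z - f zs <= (2 * Q)%N%:Z * (f z - f (cand g z k q))].
  move=> /validP Sz lt.
  have [q [m [m0 d0 cm hq]]] := best_direction Hg cfs lt.
  have lt1 : f (z + dvec N g q *+ m) < f z.
    rewrite -subr_gt0; move: hq.
    move: (f z - f (z + _)) => a; have : 0 < f z - f zs by rewrite subr_gt0.
    by move: (f z - f zs) => e; clear; nia.
  have mL : (m < 2 ^ improve_length)%N.
    have /existsP[k dk] : [exists k, dvec N g q k 0 != 0].
      apply: contraNT d0; rewrite negb_exists => /forallP h.
      by apply/eqP/colP => i; have := h i; rewrite negbK mxE [RHS]mxE => /eqP.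
    apply: (@leq_trans (2 ^ improve_length.-1)); last by rewrite leq_exp2l // leq_pred.
    apply: leq_ltn_trans (ltn_bitlen _); rewrite absz_nat.
    have := box_bounded Hg norec Sz Sz1 k; have := box_bounded Hg norec Szs Sz1 k.
    have := cm.1 k; rewrite !mxE mulmxnE -mulr_natr natz.
    move: (dvec N g q k 0) dk (z k 0) (zs k 0) (z1 k 0) (ndir _ _ * _)%N.
    by rewrite /cle; clear -m0; nia.
  have [k kL [km hk]] := power_of_two_step cfs m0 mL lt1.
  exists k, (nat_of_ord q); split=> //.
    by apply/validP; rewrite candE; exact: cand_feasible m0 km cm.
  apply: le_trans hq _; rewrite candE PoszM [2%:Z * _]mulrC -mulrA.
  exact: ler_wpM2l.
have gap0 : f z1 - f zs < (2 ^ (bitlen (fhat S f)).+1)%N%:Z.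
  have := ltn_bitlen (fhat S f); rewrite absz_nat => h.
  have h2 : (2 ^ (bitlen (fhat S f)).-1 <= 2 ^ (bitlen (fhat S f)))%N by rewrite leq_exp2l //
    leq_pred.
  have := fh z1 Sz1; have := fh zs Szs; rewrite expnS; move: h h2.
  by move: (2 ^ _)%N (2 ^ _)%N => x y; lia.
have vv : valid z1 by apply/validP.
have [m [h1 h2 h3 h4 h5]] := descent bE (fun z h => zsmin z (proj1 (validP z) h)) prog vv gap0.
exists m; split=> //; split; first by apply/validP.
by move=> z Sz; rewrite [f (iter _ _ _)]h5; exact: zsmin.
Qed.

End Phases.

(** * Computing the two descents and the recession test *)

Section PhaseComp.
Variables (r s t : nat) (A : 'M[int]_(r + s, t)) (g : nat).
Hypothesis Hg : forall n (w : 'cV[int]_(n * t)), w != 0 ->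
  exists d, [/\ d != 0, conformal (nfold A n) d w & (norm1 d <= g)%N].

Variables (G : ctx) (n : G -> nat).
Variables (l u : forall x, 'cV[\bar int]_(n x * t)) (b : forall x, 'cV[int]_(r + n x * s)).
Arguments l : clear implicits.
Arguments u : clear implicits.
Arguments b : clear implicits.
Hypotheses (cn : ptime (fun x => Leaf (n x))) (pn : pbounded n).
Hypotheses (cl : ptime (fun x => enc_evec (l x))) (cu : ptime (fun x => enc_evec (u x))).
Hypothesis cb : ptime (fun x => enc_vec (b x)).

Let N x := (n x * t)%N.
Let cN : ptime (fun x => Leaf (N x)).
Proof. by apply: ptime_muln => //; exact: (ptime_int _ t). Qed.
Let pN : pbounded N.
Proof. by rewrite /N; poly_bound. Qed.
Let pQ : pbounded (fun x => ndir (N x) g).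
Proof. by rewrite /ndir; poly_bound. Qed.

Let eV (x : G) (z : 'cV[int]_(N x)) := enc_vec z.
Let eV2 (p : vec_ext N) (z : 'cV[int]_(N (tag p))) := enc_vec z.

Lemma ptime_vec2 (o : G -> value) : ptime o -> ptime (fun p : vec_ext2 N => o (tag (tag p))).
Proof. by move=> h; exact: (ptime_weak eV2 (ptime_weak eV h)). Qed.

Lemma pbounded_vec2 (q : G -> nat) : pbounded q -> pbounded (fun p : vec_ext2 N => q (tag (tag p))).
Proof. by move=> h; exact: (pbounded_weak eV2 (pbounded_weak eV h)). Qed.

Lemma ptime_vec2_fst : ptime (fun p : vec_ext2 N => enc_vec (tagged (tag p))).
Proof. exact: (ptime_weak eV2 (ptime_top eV)). Qed.

Lemma ptime_vec2_snd : ptime (fun p : vec_ext2 N => enc_vec (tagged p)).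
Proof. exact: (ptime_top eV2). Qed.

Lemma ptime_viol2 (z : forall p : vec_ext2 N, 'cV[int]_(n (tag (tag p)) * t)) :
  ptime (fun p => enc_vec (z p)) ->
  ptime (fun p : vec_ext2 N =>
    Leaf (viol A (l (tag (tag p))) (u (tag (tag p))) (b (tag (tag p))) (z p))).
Proof.
move=> cz.
apply: (@ptime_viol _ _ _ A (vec_ext2 N) (fun p => n (tag (tag p)))
  (fun p => l (tag (tag p))) (fun p => u (tag (tag p))) (fun p => b (tag (tag p)))) => //.
- exact: (ptime_vec2 cn).
- exact: (pbounded_vec2 pn).
- exact: (ptime_vec2 cl).
- exact: (ptime_vec2 cu).
exact: (ptime_vec2 cb).
Qed.

Lemma ptime_zero : ptime (fun x => enc_vec (0 : 'cV[int]_(N x))).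
Proof.
apply: (ptime_eq _ (@ptime_col G N (fun _ _ => 0) cN pN (ptime_int _ 0))) => x.
by congr enc_vec; apply/colP => k; rewrite !mxE.
Qed.

Lemma ptime_bitlenz (f : G -> int) : ptime (fun x => Leaf (f x)) -> ptime (fun x => Leaf
  (bitlen (f x))).
Proof.
move=> cf; have := ptime_bitlen (W := fun x => `|f x|%N).
rewrite /bitlen => h; apply: (ptime_eq _ (h _)) => [x|]; first by rewrite absz_nat.
by apply: (ptime_eq _ (ptime_abs cf)) => x; rewrite abszE.
Qed.

Lemma ptime_least_violation : exists z1 : forall x, 'cV[int]_(n x * t),
  ptime (fun x => enc_vec (z1 x)) /\
  forall x z, viol A (l x) (u x) (b x) (z1 x) <= viol A (l x) (u x) (b x) z.
Proof.
have [m mP] := choice (fun x => repair_descent (l x) (u x) (b x) (@Hg (n x))).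
pose L x := repair_length A (l x) (u x) (b x).
have cv0 := ptime_viol A cn pn cl cu cb ptime_zero.
have cL : ptime (fun x => Leaf (L x)) by exact: ptime_bitlenz.
have pL : pbounded L by apply: (pbounded_le (pbounded_vsize cv0)).
exists (fun x => iter (m x) (repair_step A (l x) (u x) (b x) g) 0); split; last first.
  by move=> x; have [_ _ _] := mP x.
apply: (@ptime_descent g G N L cN pN cL pL (fun x => less_violated A (l x) (u x) (b x))
  _ (fun x => 0) ptime_zero m).
- by apply: ptime_lt; apply: ptime_viol2; [exact: ptime_vec2_snd | exact: ptime_vec2_fst].
- apply: (@pbounded_le _ _ (fun x => 2 * ndir (N x) g * L x)%N); first by poly_bound.
  by move=> x; have [] := mP x.
- by move=> x; have [] := mP x.
by move=> x; have [] := mP x.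
Qed.

(** The number of nonzero recession directions among the short ones is compared
    with 0. *)
Definition rec_test (x : G) : bool :=
  0 < \sum_(0 <= q < ndir (N x) g)
    (if (viol A (rec_lo (l x)) (rec_up (u x)) 0 (dvec (N x) g q) == 0) &&
        ~~ (\sum_(0 <= k < N x) `|ent (dvec (N x) g q) k| == 0) then 1 else 0) :> int.

Lemma ptime_rec_test : ptime (fun x => of_bool (rec_test x)).
Proof.
have cQ : ptime (fun x => Leaf (ndir (N x) g)) := ptime_ndir g cN.
have cd : ptime (fun p : extn G => enc_vec (dvec (N (tag p)) g (tagged p))).
  apply: (@ptime_col (extn G) (fun p => N (tag p)) (fun p j => dir (N (tag p)) g (tagged p) j)).
  - exact: (ptime_wn cN).
  - exact: (pbounded_wn pN).
  apply: (@ptime_dir g (extn (extn G)) (fun p => N (tag (tag p))) (fun p => tagged (tag p))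
    (fun p => tagged p)).
  - exact: (ptime_wn (ptime_wn cN)).
  - exact: (ptime_wn (ptime_topn G)).
  exact: ptime_topn.
have ceL : ptime (fun p : extn G => eent (l (tag p)) (tagged p)).
  apply: (@ptime_eent _ _ (fun p : extn G => l (tag p))); first exact: (ptime_wn cl).
  exact: ptime_topn.
have ceU : ptime (fun p : extn G => eent (u (tag p)) (tagged p)).
  apply: (@ptime_eent _ _ (fun p : extn G => u (tag p))); first exact: (ptime_wn cu).
  exact: ptime_topn.
have c0 : ptime (fun p : extn G => enc_ext 0%E) := ptime_const _ _.
have crl : ptime (fun x => enc_evec (rec_lo (l x))).
  apply: (@ptime_ecol G N (fun x k => if is_node (eent (l x) k) then 0%E else
    if (to_int (eent (l x) k) <= 0) then -oo%E else 0%E)) => //.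
  apply: (ptime_eq _ (ptime_if (ptime_is_node ceL) c0
    (ptime_if (ptime_le (ptime_to_int ceL) (ptime_int _ 0)) (ptime_const _ (enc_ext -oo%E)) c0))).
  by move=> p /=; case: ifP => _ //; case: ifP.
have cru : ptime (fun x => enc_evec (rec_up (u x))).
  apply: (@ptime_ecol G N (fun x k => if is_node (eent (u x) k) then 0%E else
    if (0 <= to_int (eent (u x) k)) then +oo%E else 0%E)) => //.
  apply: (ptime_eq _ (ptime_if (ptime_is_node ceU) c0
    (ptime_if (ptime_le (ptime_int _ 0) (ptime_to_int ceU)) (ptime_const _ (enc_ext +oo%E)) c0))).
  by move=> p /=; case: ifP => _ //; case: ifP.
have cz : ptime (fun x => enc_vec (0 : 'cV[int]_(r + n x * s))).
  apply: (ptime_eq _ (@ptime_col G (fun x => r + n x * s)%N (fun _ _ => 0) _ _ (ptime_int _ 0))).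
  - by move=> x; congr enc_vec; apply/colP => k; rewrite !mxE.
  - by apply: ptime_addn; [exact: (ptime_int _ r) | apply: ptime_muln => //;
    exact: (ptime_int _ s)].
  by poly_bound.
apply: ptime_lt; first exact: (ptime_int _ 0).
apply: (@ptime_sum G (fun x => ndir (N x) g) (fun x q =>
  if (viol A (rec_lo (l x)) (rec_up (u x)) 0 (dvec (N x) g q) == 0) &&
     ~~ (\sum_(0 <= k < N x) `|ent (dvec (N x) g q) k| == 0) then 1 else 0)) => //.
apply: ptime_ifz (ptime_int _ 1) (ptime_int _ 0); apply: ptime_and.
  apply: (ptime_eqz _ (ptime_int _ 0)).
  apply: (@ptime_viol _ _ _ A (extn G) (fun p => n (tag p))
   (fun p => rec_lo (l (tag p))) (fun p => rec_up (u (tag p))) (fun p => 0)) => //.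
  - exact: (ptime_wn cn).
  - exact: (pbounded_wn pn).
  - exact: (ptime_wn crl).
  - exact: (ptime_wn cru).
  exact: (ptime_wn cz).
apply: ptime_neg; apply: (ptime_eqz _ (ptime_int _ 0)).
apply: (@ptime_sum (extn G) (fun p => N (tag p)) (fun p k => `|ent (dvec (N (tag p)) g (tagged
  p)) k|)).
- exact: (ptime_wn cN).
- exact: (pbounded_wn pN).
apply: ptime_abs; apply: (@ptime_ent _ _ (fun p : extn (extn G) => dvec (N (tag (tag p))) g
  (tagged (tag p)))).
  exact: (ptime_wn cd).
exact: ptime_topn.
Qed.

Lemma rec_termP x (q : nat) :
  (viol A (rec_lo (l x)) (rec_up (u x)) 0 (dvec (N x) g q) == 0) &&
        ~~ (\sum_(0 <= k < N x) `|ent (dvec (N x) g q) k| == 0) <->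
  dvec (N x) g q != 0 /\ recession A (l x) (u x) (dvec (N x) g q).
Proof.
set d := dvec _ _ _.
have e : (\sum_(0 <= k < N x) `|ent d k| == 0) = (d == 0).
  rewrite big_mkord psumr_eq0 //; apply/allP/eqP => [h|->].
    apply/colP => k; have /= := h k (mem_index_enum _); rewrite entE normr_eq0 => /eqP ->.
    by rewrite mxE.
  by move=> k _; rewrite /= entE mxE normr0.
by rewrite e; split=> [/andP[/eqP/viol_eq0 h1 h2]|[h1 /viol_eq0 ->]] //; rewrite h1 eqxx.
Qed.

Lemma rec_testT x : rec_test x -> exists d : 'cV[int]_(n x * t),
  d != 0 /\ recession A (l x) (u x) d.
Proof.
move=> h; apply: contrapT => no; move: h; rewrite /rec_test big1_seq ?ltxx // => q _.
by case: ifP => // /rec_termP hq; case: no; exists (dvec (N x) g q).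
Qed.

Lemma rec_testF x : ~~ rec_test x -> forall q : 'I_(ndir (N x) g),
  dvec (N x) g q != 0 -> ~ recession A (l x) (u x) (dvec (N x) g q).
Proof.
rewrite /rec_test -leNgt => h q d0 rd; move: h; apply/negP; rewrite -ltNge.
rewrite big_mkord (bigD1 q) //= ifT; last by apply/rec_termP.
by rewrite ltr_pwDl // sumr_ge0 // => i _; case: ifP.
Qed.

Section Phase2Comp.
Variable f : forall x, 'cV[int]_(n x * t) -> int.
Arguments f : clear implicits.
Variable z1 : forall x, 'cV[int]_(n x * t).
Hypothesis cz1 : ptime (fun x => enc_vec (z1 x)).
Hypothesis orcE : forall x z c, orc x (enc_vec z) (enc_vec c) = (f x z <= f x c).
Hypothesis fconv : forall x, separable_convex (f x).
Hypothesis fz1 : forall x, feasible A (l x) (u x) (b x) (z1 x).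
Hypothesis norec : forall x, ~~ rec_test x.
Hypothesis pfhat : pbounded (fun x => bitlen (fhat (feasible A (l x) (u x) (b x)) (f x))).

Lemma ptime_box_size : ptime (fun x => Leaf (box_size (l x) (u x) (z1 x))).
Proof.
have ceL : ptime (fun p : extn G => eent (l (tag p)) (tagged p)).
  apply: (@ptime_eent _ _ (fun p : extn G => l (tag p))); first exact: (ptime_wn cl).
  exact: ptime_topn.
have ceU : ptime (fun p : extn G => eent (u (tag p)) (tagged p)).
  apply: (@ptime_eent _ _ (fun p : extn G => u (tag p))); first exact: (ptime_wn cu).
  exact: ptime_topn.
have := @ptime_sum G N (fun x k => `|to_int (apply1 Snd (eent (l x) k))| +
       `|to_int (apply1 Snd (eent (u x) k))| + `|ent (z1 x) k|) cN pN.
move=> h; apply: (ptime_eq _ (ptime_abs (h _))).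
  by move=> x; rewrite -abszE.
apply: ptime_add; first apply: ptime_add.
- exact: (ptime_abs (ptime_to_int (ptime_op1 Snd ceL))).
- exact: (ptime_abs (ptime_to_int (ptime_op1 Snd ceU))).
apply: ptime_abs; apply: (@ptime_ent _ _ (fun p : extn G => z1 (tag p)));
  first exact: (ptime_wn cz1).
exact: ptime_topn.
Qed.

Lemma ptime_minimizer : exists z2 : forall x, 'cV[int]_(n x * t),
  ptime (fun x => enc_vec (z2 x)) /\
  forall x, minimizer (feasible A (l x) (u x) (b x)) (f x) (z2 x).
Proof.
have [m mP] := choice (fun x => improve_descent (@Hg (n x)) (fconv x) (fz1 x) (rec_testF (norec
  x))).
pose L x := improve_length (l x) (u x) g (z1 x).
have cW : ptime (fun x => Leaf (2 * (ndir (N x) g * (box_size (l x) (u x) (z1 x) * g)))%N).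
  apply: ptime_muln; first exact: (ptime_int _ 2).
  apply: ptime_muln; first exact: ptime_ndir.
  by apply: ptime_muln; [exact: ptime_box_size | exact: (ptime_int _ g)].
have cL : ptime (fun x => Leaf (L x)) by exact: ptime_bitlen.
have pL : pbounded L by apply: (pbounded_le (pbounded_vsize cW)).
exists (fun x => iter (m x) (improve_step A (l x) (u x) (b x) g (f x) (z1 x)) (z1 x)); split;
  last first.
  by move=> x; have [_ _ _] := mP x.
apply: (@ptime_descent g G N L cN pN cL pL (fun x => cheaper A (l x) (u x) (b x) (f x))
  _ z1 cz1 m).
- apply: ptime_and.
    by apply: (ptime_eqz _ (ptime_int _ 0)); apply: ptime_viol2; exact: ptime_vec2_snd.
  apply: ptime_neg; apply: (ptime_eq _ (ptime_query ptime_vec2_fst ptime_vec2_snd)) => p.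
  by congr of_bool; exact: orcE.
- apply: (@pbounded_le _ _ (fun x => 2 * ndir (N x) g *
     (bitlen (fhat (feasible A (l x) (u x) (b x)) (f x))).+1)%N).
    by poly_bound.
  by move=> x; have [] := mP x.
- by move=> x; have [] := mP x.
by move=> x; have [] := mP x.
Qed.

End Phase2Comp.
End PhaseComp.

(** * The algorithm *)

Lemma enc_vec_inj (N : nat) : injective (@enc_vec N).
Proof.
move=> x y e; apply/colP => k.
have h (z : 'cV[int]_N) : nth (Leaf 0) [seq Leaf (z i 0) | i <- enum 'I_N] k = Leaf (z k 0).
  by rewrite nth_enum_map valK.
have inj s1 s2 : enc_list s1 = enc_list s2 -> forall j, nth (Leaf 0) s1 j = nth (Leaf 0) s2 j.
  elim: s1 s2 => [|a s1 IH] [|c s2] //= [-> /IH e'] [|j] //=.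
by move: e => /inj/(_ k); rewrite !h => -[].
Qed.

Lemma cmp_oracleE (N : nat) (f : 'cV[int]_N -> int) x y :
  cmp_oracle f (enc_vec x) (enc_vec y) = (f x <= f y).
Proof.
apply/asboolP/idP => [[x' [y' [/enc_vec_inj -> /enc_vec_inj -> //]]]|h].
by exists x, y.
Qed.

Lemma vsize_evec_le (N : nat) (l : 'cV[\bar int]_N) :
  (vsize (enc_evec l) <= 4 * bitlen_evec l + 1)%N.
Proof.
rewrite /enc_evec vsize_enc_list big_map big_enum /bitlen_evec big_distrr /= leq_add2r.
apply: leq_sum => i _; case: (l i 0) => [z||] //=.
have := bitlen_gt0 z; rewrite [bitlen 0]/bitlen up_log1; lia.
Qed.

Lemma vsize_vec_le (N : nat) (z : 'cV[int]_N) :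
  (vsize (enc_vec z) <= 2 * bitlen_vec z + 1)%N.
Proof.
rewrite vsize_enc_vec /bitlen_vec big_distrr /= leq_add2r.
by apply: leq_sum => i _; have := bitlen_gt0 (z i 0); lia.
Qed.

Section Instances.
Variables (r s t : nat) (A : 'M[int]_(r + s, t)).

Record instance := Instance {
  in_n : nat;
  in_l : 'cV[\bar int]_(in_n * t);
  in_u : 'cV[\bar int]_(in_n * t);
  in_b : 'cV[int]_(r + in_n * s);
  in_f : 'cV[int]_(in_n * t) -> int;
  in_n_gt0 : (0 < in_n)%N;
  in_convex : separable_convex in_f }.
Arguments in_l : clear implicits.
Arguments in_u : clear implicits.
Arguments in_b : clear implicits.
Arguments in_f : clear implicits.

Definition in_set (x : instance) : set ('cV[int]_(in_n x * t)) :=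
  feasible A (in_l x) (in_u x) (in_b x).
Arguments in_set : clear implicits.

Definition in_bits (x : instance) : nat :=
  (bitlen_evec (in_l x) + bitlen_evec (in_u x) + bitlen_vec (in_b x)
   + bitlen (fhat (in_set x) (in_f x)))%N.

(** The size of an instance includes the bit length of the maximum of |f|, which the
    program does not see. *)
Definition in_ctx : ctx :=
  @Ctx instance (fun x => cmp_oracle (in_f x)) (fun x => in_n x + in_bits x)%N
    (fun x => enc_input (in_n x) (in_l x) (in_u x) (in_b x)).

Lemma insize_le (x : in_ctx) : (insize x <= 20 * (in_n x + in_bits x) + 20)%N.
Proof.
rewrite /insize /= /in_bits; have := bitlen_nat (in_n x).
have := vsize_evec_le (in_l x); have := vsize_evec_le (in_u x).
have := vsize_vec_le (in_b x); lia.
Qed.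

(** The second descent runs only if the first one ends at a feasible point and no
    short recession direction exists, since otherwise it need not terminate. *)
Lemma ptime_solution : exists a : forall x : instance, answer (in_n x * t),
  ptime (fun x : in_ctx => enc_answer (a x)) /\
  forall x, solves (in_set x) (in_f x) (a x).
Proof.
have [g Hg] := graver_bound A.
have ci := @ptime_inp in_ctx.
have cn : ptime (fun x : in_ctx => Leaf (in_n x)) := ptime_fst ci.
have cl : ptime (fun x : in_ctx => enc_evec (in_l x)) := ptime_fst (ptime_snd ci).
have cu : ptime (fun x : in_ctx => enc_evec (in_u x)) := ptime_fst (ptime_snd (ptime_snd ci)).
have cb : ptime (fun x : in_ctx => enc_vec (in_b x)) := ptime_snd (ptime_snd (ptime_snd ci)).
have pn : pbounded (fun x : in_ctx => in_n x).
  by apply: (pbounded_le (@pbounded_sz in_ctx)) => x /=; lia.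
have [z1 [cz1 z1min]] := ptime_least_violation Hg cn pn cl cu cb.
pose v1 x := viol A (in_l x) (in_u x) (in_b x) (z1 x).
pose rt (x : in_ctx) := rec_test A g (fun x : in_ctx => in_l x) (fun x : in_ctx => in_u x) x.
pose c x := (v1 x == 0) && ~~ rt x.
have cv : ptime (fun x : in_ctx => of_bool (v1 x == 0)).
  by apply: (ptime_eqz _ (ptime_int _ 0)); exact: ptime_viol.
have cc : ptime (fun x : in_ctx => of_bool (c x)).
  apply: ptime_and => //; apply: ptime_neg; exact: ptime_rec_test.
have [z2 [cz2 z2min]] : exists z2 : forall p : @restr in_ctx (fun x => c x),
      'cV[int]_(in_n (sval p) * t),
    ptime (fun p : @restr in_ctx (fun x => c x) => enc_vec (z2 p)) /\
    forall p, minimizer (in_set (sval p)) (in_f (sval p)) (z2 p).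
  apply: (@ptime_minimizer _ _ _ A g Hg (@restr in_ctx (fun x => c x)) (fun p => in_n (sval p))
    (fun p => in_l (sval p)) (fun p => in_u (sval p)) (fun p => in_b (sval p))
    _ _ _ _ _ (fun p => in_f (sval p)) (fun p => z1 (sval p))).
  - exact: ptime_restr cn.
  - by case: pn => k hk; exists k => p; exact: hk.
  - exact: ptime_restr cl.
  - exact: ptime_restr cu.
  - exact: ptime_restr cb.
  - exact: ptime_restr cz1.
  - by move=> p z z'; exact: cmp_oracleE.
  - by move=> p; exact: in_convex.
  - by move=> p; have /andP[/eqP h _] := svalP p; apply/viol_eq0.
  - by move=> p; have /andP[_ h] := svalP p; exact: h.
  by apply: (pbounded_le (@pbounded_sz (@restr in_ctx (fun x => c x)))) => p /=;
    rewrite /in_bits /in_set; lia.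
pose a (x : instance) : answer (in_n x * t) :=
  match pselect (c x) with
  | left h => Optimal (z2 (exist _ x h))
  | right _ => if v1 x == 0 then Defs.Infinite else Defs.Empty
  end.
exists a; split.
  pose dflt x := if v1 x == 0 then Leaf 1 else Leaf 0.
  have := @ptime_if_restr in_ctx c (fun x => enc_answer (a x)) dflt cc.
  move=> h; apply: (ptime_eq _ (h _ _)).
  - move=> x; case: ifP => // /negP h0; rewrite /a; case: pselect => // _.
    by rewrite /dflt; case: ifP.
  - apply: (ptime_eq _ (ptime_node (ptime_int _ 0) cz2)) => -[x hx] /=.
    rewrite /a; case: pselect => // hx'; by rewrite (bool_irrelevance hx hx').
  apply: (@ptime_restr in_ctx _ dflt).
  by apply: (ptime_if cv); exact: ptime_const.
move=> x; rewrite /a; case: pselect => [h|h] /=; first exact: (z2min (exist _ x h)).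
have [v0|v0] := boolP (v1 x == 0) => /=.
  have rx : rt x by apply: contraT => nr; case: h; rewrite /c v0.
  have [d [d0 rd]] := @rec_testT _ _ _ A g in_ctx (fun x => in_n x)
    (fun x => in_l x) (fun x => in_u x) x rx.
  have Sz : in_set x (z1 x) by apply/viol_eq0/eqP.
  exact: (recession_infinite Sz d0 rd).
apply/seteqP; split=> // z /viol_eq0 vz; move: v0; apply: contraNP => _.
have := z1min x z; rewrite vz -/(v1 x) => le.
by rewrite eq_le le; exact: viol_ge0.
Qed.

End Instances.

Theorem theorem1p2 (r s t : nat) (A : 'M[int]_(r + s, t)) :
  exists (P : expr) (p : {poly {poly nat}}),
  forall (n : nat) (l u : 'cV[\bar int]_(n * t)) (b : 'cV[int]_(r + n * s))
         (f : 'cV[int]_(n * t) -> int),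
  (0 < n)%N -> separable_convex f ->
  exists (a : answer (n * t)) (T : nat),
    [/\ eval (cmp_oracle f) [:: enc_input n l u b] P (enc_answer a) T,
        solves (feasible A l u b) f a
      & (T <= p.[n, (bitlen_evec l + bitlen_evec u + bitlen_vec b
                     + bitlen (fhat (feasible A l u b) f))%N]%R)%N].
Proof.
have [a [[P [q [[k hq] hP]]] sol]] := ptime_solution A.
(* The polynomial (20 (X + Y + 1))^k; the outer variable is evaluated at n. *)
exists P; exists ((('X + ('X)%:P + 1%N%:P%:P) * 20%N%:P%:P) ^+ k) => n l u b f n0 cf.
pose x : in_ctx A := Instance l u b n0 cf.
have [T ev le] := hP x [::].
exists (a x), T; split=> //; first exact: (sol x).
apply: leq_trans (leq_trans le (hq x)) _.
rewrite !horner_exp !hornerM !hornerD !hornerX !hornerC hornerX.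
change (insize x ^ k <= ((n + in_bits A x + 1) * 20) ^ k)%N.
apply: leq_exp2l_base; apply: leq_trans (insize_le x) _; rewrite /=; lia.
Qed.
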